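(* Let $X$ and $Y$ be locally compact non-separable metrizable spaces, and suppose that at least one of $X$ and $Y$ has weight greater than $2^{\aleph_0}$. Let $\omega\sigma X=\sigma X\cup\{\Omega\}$ and $\omega\sigma Y=\sigma Y\cup\{\Omega'\}$ be the one-point compactifications of $\sigma X$ and $\sigma Y$, respectively. If $\omega\sigma X\setminus X$ and $\omega\sigma Y\setminus Y$ are homeomorphic, then $\mathcal{E}_K(X)$ and $\mathcal{E}_K(Y)$ are order-isomorphic.
   Context: For a non-compact metrizable space $X$, $\mathcal{E}(X)$ denotes the set of all one-point metrizable extensions of $X$, i.e. metrizable spaces $Y=X\cup\{p\}$ with $p\notin X$ containing $X$ as a dense subspace, where two such extensions are identified if there is a homeomorphism between them fixing $X$ pointwise. $\mathcal{E}(X)$ is partially ordered by: $Y_1\leq Y_2$ if there is a continuous function from $Y_2$ into $Y_1$ fixing $X$ pointwise. For $X$ locally compact, $\mathcal{E}_K(X)$ is the set of those elements of $\mathcal{E}(X)$ that are locally compact, with the induced order. An order-isomorphism is a bijection that preserves order in both directions. For $X$ locally compact non-separable metrizable, $\sigma X$ is the set of those points of the Stone-Čech compactification $\beta X$ that lie in the closure in $\beta X$ of some $\sigma$-compact subset of $X$; it is an open (hence locally compact) subspace of $\beta X$ containing $X$. *)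

(* Defs.v *)
From mathcomp Require Import all_boot all_order all_algebra.
From mathcomp Require Import all_classical all_reals topology.
Import Order.TTheory GRing.Theory Num.Theory numFieldTopology.Exports.

Set Implicit Arguments.
Unset Strict Implicit.
Unset Printing Implicit Defensive.

Local Open Scope classical_set_scope.
Local Open Scope card_scope.
Local Open Scope ring_scope.

Definition homeomorphism (S T : topologicalType) (f : S -> T) :=
  continuous f /\
  exists g : T -> S, [/\ continuous g, cancel f g & cancel g f].

Definition homeomorphic (S T : topologicalType) :=
  exists f : S -> T, homeomorphism f.

Definition embedding (S T : topologicalType) (f : S -> T) :=
  injective f /\ open = [set f @^-1` B | B in open].

Definition metrizable (R : realType) (X : topologicalType) :=
  exists M : metricType R, homeomorphic X M.

Definition separable (X : topologicalType) :=
  exists2 D : set X, countable D & dense D.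

Definition sigma_compact (X : topologicalType) (A : set X) :=
  exists2 K : nat -> set X, (forall n, compact (K n)) & A = \bigcup_n K n.

(* The weight of X is the least cardinality of a basis, represented here by a
   set K of that cardinality. *)
Definition has_weight (X : topologicalType) (T : Type) (K : set T) :=
  (exists2 B : set (set X), basis B & B #= K) /\
  (forall B : set (set X), basis B -> K #<= B).

Definition weight_gt (X : topologicalType) (T : Type) (L : set T) :=
  exists K : set (set X), [/\ has_weight X K, L #<= K & L #!= K].

(* The Stone-Cech compactification of a Tychonoff space X: the closure of the
   image of X under the evaluation map into the Tychonoff cube [0, 1]^I, where
   I is the set of continuous functions X -> [0, 1]. The cube is closed in the
   product R^I (topology of pointwise convergence), so that taking the closure
   in R^I gives the same space. *)
Section stone_cech.
Variables (R : realType) (X : topologicalType).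

Definition unit_interval_maps : set (X -> R) :=
  [set f : X -> R | continuous f /\ forall x : X, 0 <= f x <= 1].

Definition eval_map :=
  join_product (fun f : set_type unit_interval_maps => set_val f : X -> R).

Definition stone_cech : topologicalType := set_type (closure (range eval_map)).

Definition stone_cech_in (x : X) : stone_cech :=
  SigSub (mem_set (subset_closure (imageT eval_map x))).

Definition sigma_set : set stone_cech :=
  [set p | exists2 A : set X, sigma_compact A & closure (stone_cech_in @` A) p].

Definition omega_sigma : topologicalType := one_point_compactification sigma_set.

(* The copy of X inside omega sigma X. *)
Definition omega_sigma_image : set omega_sigma :=
  [set Some p | p in [set p : sigma_set | range stone_cech_in (set_val p)]].

Definition omega_sigma_remainder : topologicalType := set_type (~` omega_sigma_image).

End stone_cech.

(* The underlying set of a one-point extension of X is option X, the disjoint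
   union of X and the point p = None. As extensions are identified when they
   are homeomorphic over X, the choice of p is immaterial. *)
Section one_point_extensions.
Variables (R : realType) (X : topologicalType).

Definition with_topology (t : Topological (option X)) : topologicalType :=
  Topological.Pack t.

Record one_point_ext := OnePointExt {
  ext_topology : Topological (option X);
  ext_metrizable : metrizable R (with_topology ext_topology);
  ext_embedding : @embedding X (with_topology ext_topology) Some;
  ext_dense : @dense (with_topology ext_topology) (range Some) }.

Definition ext_space (Y : one_point_ext) : topologicalType :=
  with_topology (ext_topology Y).

Coercion ext_space : one_point_ext >-> Topological.type.

Definition ext_in (Y : one_point_ext) : X -> Y := Some.

Definition ext_equiv (Y1 Y2 : one_point_ext) :=
  exists2 h : Y1 -> Y2, homeomorphism h & forall x, h (ext_in Y1 x) = ext_in Y2 x.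

Definition ext_le (Y1 Y2 : one_point_ext) :=
  exists2 g : Y2 -> Y1, continuous g & forall x, g (ext_in Y2 x) = ext_in Y1 x.

Definition ext_classes : set (set one_point_ext) :=
  [set [set Z | ext_equiv Y Z] | Y in [set: one_point_ext]].

Definition ext_classes_K : set (set one_point_ext) :=
  ext_classes `&`
  [set C | exists2 Y : one_point_ext, C Y & locally_compact [set: Y]].

Definition ext_class_le (C1 C2 : set one_point_ext) :=
  exists Y1 Y2, [/\ C1 Y1, C2 Y2 & ext_le Y1 Y2].

End one_point_extensions.

Arguments ext_classes R X : clear implicits.
Arguments ext_classes_K R X : clear implicits.
Arguments ext_class_le R X : clear implicits.

Definition order_isomorphic (T U : Type) (A : set T) (B : set U)
    (leA : T -> T -> Prop) (leB : U -> U -> Prop) :=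
  exists f : T -> U, set_bij A B f /\
    forall x y, A x -> A y -> (leA x y <-> leB (f x) (f y)).

(* Main.v *)
Require Import Defs.
From HB Require Import structures.
From mathcomp Require Import all_boot all_order all_algebra.
From mathcomp Require Import all_classical all_reals topology normedtype.
From mathcomp Require Import lra.
Import Order.TTheory GRing.Theory Num.Theory numFieldNormedType.Exports.

Set Implicit Arguments.
Unset Strict Implicit.
Unset Printing Implicit Defensive.

Local Open Scope classical_set_scope.
Local Open Scope card_scope.
Local Open Scope ring_scope.

(** The added point p of a locally compact one-point extension of X is described
    by its trace in the Stone-Cech compactification: the intersection, over the
    neighborhoods U of p, of the closures of the sets U \ {p}. If g is the
    distance to p, truncated at 1, the trace is also the zero set of the
    continuous extension of g, which in the present construction of the
    compactification is the coordinate projection of index g (sc_ext). A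
    compactness argument shows that Y1 <= Y2 exactly when the trace of Y2 is
    contained in that of Y1 (ext_leP), so the trace determines the class of the
    extension (ext_equivP) and reverses the order.

    The traces of the locally compact extensions are exactly the nonempty compact
    sets K that are open in the remainder sigma X \ X. In one direction
    (ext_trace_locally_compact), the shells s <= g <= r are compact for some r
    and all s > 0, so that the points of the compactification where g is
    positive and less than r lie in X. In the other (trace_realization), K
    lies in the closure of a clopen sigma-compact set B; combining a function
    that vanishes at infinity on B with a Urysohn function for K yields a gauge
    g whose extension vanishes exactly on K, and g defines a metric on X
    together with one more point (gauge_extension_exists).

    A homeomorphism between the remainders of omega sigma X and omega sigma Y
    that sends Omega to Omega' therefore induces the order isomorphism
    (order_isomorphic_of_remainder_homeo). That it does send Omega to Omega' is
    where the weight enters (remainder_homeo_pt). A point other than Omega lies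
    in the closure of a separable clopen set and so has a neighborhood with a
    dense subset of size at most the continuum. If X has weight greater than
    the continuum, Omega has no such neighborhood: continuum many points of the
    remainder are carried by continuum many clopen sigma-compact sets, and
    so many cannot exhaust X, even up to one more such set. The clopen
    sigma-compact sets come from a decomposition of X into classes (saturated,
    block) that plays the role of the decomposition of X into a topological sum
    of sigma-compact spaces. *)

(** * Compactness by finite subcovers *)

Lemma compact_finite_subcover (T : topologicalType) (A : set T) (I : eqType)
    (f : I -> set T) :
  compact A -> (forall i, open (f i)) -> A `<=` \bigcup_i f i ->
  exists s : seq I, A `<=` \bigcup_(i in [set` s]) f i.
Proof.
move=> cA fo Af; apply: contrapT => /forallNP nos.
(* the parts of A left uncovered by finite subfamilies form a filter base *)
pose B (s : seq I) := A `\` \bigcup_(i in [set` s]) f i.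
have FF : Filter (filter_from [set: seq I] B).
  apply: filter_from_filter; first by exists [::].
  move=> s t _ _; exists (s ++ t) => // x [Ax H].
  by split; split=> // -[i /= si fx]; apply: H; exists i => //=;
    rewrite mem_cat si ?orbT.
have PF : ProperFilter (filter_from [set: seq I] B).
  apply: filter_from_proper => s _.
  by have /existsNP[x /not_implyP[Ax H]] := nos s; exists x.
have [|x [Ax]] := cA _ PF; first by exists [::] => // x [].
rewrite clusterE => clx.
have [i _ fix_] := Af _ Ax.
have /clx : filter_from [set: seq I] B (B [:: i]) by exists [:: i].
move=> /(_ (f i)) []; first by apply: open_nbhs_nbhs; split.
by move=> y [[_ H] fy]; apply: H; exists i => //=; rewrite inE.
Qed.

(** * Metrics compatible with a topology *)

Section compatible_metric.
Variables (R : realType) (X : topologicalType).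

(** The distance is kept apart from the type X, whose topology is the given one;
    a metric structure on X would come with a topology of its own. *)
Record compatible_metric (d : X -> X -> R) : Prop := CompatibleMetric {
  cm_refl : forall x, d x x = 0 ;
  cm_eq0 : forall x y, d x y = 0 -> x = y ;
  cm_sym : forall x y, d x y = d y x ;
  cm_triangle : forall y x z, d x z <= d x y + d y z ;
  cm_nbhs : forall x A,
    nbhs x A <-> exists2 e : R, 0 < e & forall y, d x y < e -> A y }.

Lemma metrizable_compatible : metrizable R X -> exists d, compatible_metric d.
Proof.
move=> [M [f [cf [g [cg fg gf]]]]].
have nbM (p : M) A : nbhs p A <-> exists2 e : R, 0 < e & forall y, mdist p y < e -> A y.
  rewrite -(metricType_numDomainType.filter_from_mdist_nbhs p).
  by split=> -[e e0 H]; exists e.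
exists (fun x y => mdist (f x) (f y)); split.
- by move=> x; rewrite mdistxx.
- by move=> x y /mdist_positivity/(can_inj fg).
- by move=> x y; rewrite metric_sym.
- by move=> y x z; rewrite metric_triangle.
- move=> x A; split=> [xA|[e e0 H]].
    have /nbM[e e0 H] : nbhs (f x) (g @^-1` A) by apply: cg; rewrite fg.
    by exists e => // y /H /=; rewrite fg.
  apply: (filterS H); apply: (cf x [set z | mdist (f x) z < e]).
  by apply/nbM; exists e.
Qed.

Variable d : X -> X -> R.
Hypothesis dP : compatible_metric d.

Let drefl := cm_refl dP.
Let deq0 := cm_eq0 dP.
Let dsym := cm_sym dP.
Let dtri := cm_triangle dP.
Let dnbhs := cm_nbhs dP.

Lemma cm_ge0 x y : 0 <= d x y.
Proof. by have := dtri y x x; rewrite drefl (dsym y x); lra. Qed.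

Lemma cm_gt0 x y : x <> y -> 0 < d x y.
Proof.
move=> xy; rewrite lt_neqAle cm_ge0 andbT eq_sym.
by apply/eqP => /deq0.
Qed.

Lemma lipschitz_continuous (f : X -> R) :
  (forall x y, f x <= f y + d x y) -> continuous f.
Proof.
move=> fl x; apply/cvgrPdist_lt => e e0; near=> y.
have : d x y < e by near: y; apply/dnbhs; exists e.
have := fl x y; have := fl y x; rewrite (dsym y x) ltr_norml; lra.
Unshelve. all: by end_near. Qed.

Lemma dist_continuous x : continuous (d x).
Proof. by apply: lipschitz_continuous => y z; rewrite (dsym y z) dtri. Qed.

Lemma open_ball x r : open [set y | d x y < r].
Proof.
by have := open_comp (fun y _ => @dist_continuous x y) (@open_lt R r); apply.
Qed.

Lemma closed_cball x r : closed [set y | d x y <= r].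
Proof.
by have := closed_comp (fun y _ => @dist_continuous x y) (@closed_le R r); apply.
Qed.

Lemma cm_hausdorff : hausdorff_space X.
Proof.
move=> x y xy; apply: contrapT => /cm_gt0 dxy.
have nb z : nbhs z [set t | d z t < d x y / 2].
  by apply/dnbhs; exists (d x y / 2) => //; lra.
have [z [/=]] := xy _ _ (nb x) (nb y).
by have := dtri z x y; rewrite (dsym z y); lra.
Qed.

(** A radius of compactness that varies slowly: the supremum of the admissible
    radii is 1-Lipschitz, and halving it keeps the closed balls compact. *)
Lemma compact_radius : locally_compact [set: X] ->
  exists rho : X -> R, [/\ forall x, 0 < rho x,
    forall x y, rho x <= rho y + d x y
    & forall x, compact [set y | d x y <= rho x]].
Proof.
move=> lc.
pose good x := [set r : R | 0 <= r <= 1 /\ compact [set y | d x y <= r]].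
have good0 x : good x 0.
  split; first by rewrite lexx ler01.
  rewrite (_ : [set y | _] = [set x]); first exact: compact_set1.
  apply/seteqP; split=> [y /= h|y /= ->]; last by rewrite drefl.
  by apply/esym/deq0; apply/eqP; rewrite eq_le h cm_ge0.
have hub x : has_ubound (good x) by exists 1 => r [/andP[]].
have hs x : has_sup (good x) by split; [exists 0|exact: hub].
have ub x r : good x r -> r <= sup (good x) by move=> ?; apply: ub_le_sup.
have sub x s t : s <= t -> compact [set y | d x y <= t] ->
    compact [set y | d x y <= s].
  move=> st ct; apply: (subclosed_compact _ ct); first exact: closed_cball.
  by move=> y /= /le_trans; apply.
have spos x : 0 < sup (good x).
  have [C] := lc x I; rewrite withinET; move=> xC [cC _].
  have xC' : nbhs x C by apply: filterS xC => y; apply.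
  have [e e0 eC] := (dnbhs x C).1 xC'.
  pose r := Order.min (e / 2) 1.
  have r0 : 0 < r by rewrite lt_min ltr01 andbT; lra.
  apply: (lt_le_trans r0); apply: ub; split.
    by apply/andP; split; [apply: ltW|rewrite ge_min lexx orbT].
  apply: (subclosed_compact _ cC); first exact: closed_cball.
  move=> y /= h; apply: eC; apply: le_lt_trans h _.
  by apply: (@le_lt_trans _ _ (e / 2)); [rewrite ge_min lexx|lra].
have slip x y : sup (good x) <= sup (good y) + d x y.
  apply: ge_sup; first by exists 0.
  move=> r [r01 cr]; have [dr|dr] := leP r (d x y).
    by have := spos y; lra.
  suff : good y (r - d x y) by move=> /ub; lra.
  split; first by have := cm_ge0 x y; lra.
  apply: (subclosed_compact _ cr); first exact: closed_cball.
  by move=> z /=; have := dtri y x z; lra.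
exists (fun x => sup (good x) / 2); split=> [x|x y|x].
- by have := spos x; lra.
- by have := slip x y; have := cm_ge0 x y; lra.
- have := spos x => sx; have h : 0 < sup (good x) / 2 by lra.
  have [r [r01 cr] hr] := sup_adherent h (hs x).
  by apply: sub cr; lra.
Qed.

End compatible_metric.

(** * Decomposing a locally compact metrizable space into blocks *)

Section blocks.
Variables (R : realType) (X : topologicalType) (d : X -> X -> R).
Hypothesis dP : compatible_metric d.

Let drefl := cm_refl dP.
Let dsym := cm_sym dP.
Let dtri := cm_triangle dP.
Let dnbhs := cm_nbhs dP.
Let dge0 := cm_ge0 dP.

Variable rho : X -> R.
Hypothesis rho_gt0 : forall x, 0 < rho x.
Hypothesis rho_lip : forall x y, rho x <= rho y + d x y.
Hypothesis rho_compact : forall x, compact [set y | d x y <= rho x].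

Let rball x := [set y | d x y < rho x].
Let rcball x := [set y | d x y <= rho x].

Definition near_pts x y := d x y < rho x / 4 /\ d x y < rho y / 4.

(** As near_pts is symmetric, the saturated sets form a complete Boolean algebra
    of sets; as near_pts x contains a ball about x, they are all clopen. *)
Definition saturated (B : set X) := forall x y, B x -> near_pts x y -> B y.

(** The balls of radius rho have compact closure, so a block is a saturated set
    that is sigma-compact; the explicit sequence of balls is what the block
    functions and the dense sequences below are built from. *)
Definition block (B : set X) :=
  saturated B /\ exists c : nat -> X, B = \bigcup_n rball (c n).

Lemma saturatedC B : saturated B -> saturated (~` B).
Proof.
move=> sB x y nBx [h1 h2] By; apply: nBx; apply: (sB y) => //.
by split; rewrite (dsym y x).
Qed.

Lemma saturated_bigcup (I : Type) (D : set I) (F : I -> set X) :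
  (forall i, D i -> saturated (F i)) -> saturated (\bigcup_(i in D) F i).
Proof. by move=> sF x y [i Di Fx] xy; exists i => //; apply: sF xy. Qed.

Lemma saturated_bigcap (I : Type) (D : set I) (F : I -> set X) :
  (forall i, D i -> saturated (F i)) -> saturated (\bigcap_(i in D) F i).
Proof. by move=> sF x y Fx xy i Di; apply: (sF i Di x) => //; exact: Fx. Qed.

Lemma saturated_open B : saturated B -> open B.
Proof.
move=> sB; rewrite openE => x Bx; apply/dnbhs; exists (rho x / 8).
  by have := rho_gt0 x; lra.
move=> y dxy; apply: (sB x) => //; have := rho_lip x y; have := rho_gt0 x.
by split; lra.
Qed.

Lemma saturated_clopen B : saturated B -> clopen B.
Proof.
move=> sB; split; first exact: saturated_open.
by rewrite -[B]setCK; apply: open_closedC; apply: saturated_open; apply: saturatedC.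
Qed.

(** Starting from x, cover each compact ball already reached by finitely many
    balls of a quarter of the radius and iterate: the balls so obtained are
    countably many, and the overlap forces their union to be saturated. *)
Lemma block_ex x : exists2 B, block B & B x.
Proof.
have step s : exists t : seq X,
    rcball s `<=` \bigcup_(z in [set` t]) [set y | d z y < rho z / 4].
  apply: compact_finite_subcover; first exact: rho_compact.
    by move=> z; apply: (open_ball dP).
  by move=> z _; exists z => //=; rewrite drefl; have := rho_gt0 z; lra.
have {step} [F FP] := choice step.
(* the centres reached after k steps *)
pose L k := iter k (fun s => flatten (map F s)) [:: x].
pose c n := if @unpickle (nat * nat)%type n is Some (k, i) then nth x (L k) i else x.
have cL k s : s \in L k -> exists n, c n = s.
  move=> /(nthP x)[i _ <-]; exists (pickle (k, i)).
  by rewrite /c pickleK.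
have Lc n : exists k, c n \in L k.
  rewrite /c; case: unpickle => [[k i]|]; last by exists 0%N; rewrite inE.
  have [h|h] := ltnP i (size (L k)); first by exists k; rewrite mem_nth.
  by exists 0%N; rewrite nth_default// inE.
exists (\bigcup_n rball (c n)); last first.
  have [n cn] : exists n, c n = x by apply: (cL 0%N); rewrite inE.
  by exists n => //=; rewrite /rball/= cn drefl.
split; last by exists c.
move=> y z [n _ /= /ltW cny] [yz _].
have [k cLk] := Lc n.
have [t /= tF /= ty] := FP _ _ cny.
have [m cm] : exists m, c m = t.
  by apply: (cL k.+1); apply/flattenP; exists (F (c n)) => //; apply: map_f.
exists m => //=; rewrite /rball /= cm.
by have := rho_gt0 t; have := dtri y t z; have := rho_lip y t; rewrite (dsym y t); lra.
Qed.

Lemma block_bigcup (B : nat -> set X) :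
  (forall n, block (B n)) -> block (\bigcup_n B n).
Proof.
move=> bB; split; first by apply: saturated_bigcup => n _; case: (bB n).
have [c cP] := choice (fun n => (bB n).2).
pose c' n := if @unpickle (nat * nat)%type n is Some (k, i) then c k i else c 0%N 0%N.
exists c'; apply/seteqP; split=> x [n _].
  rewrite cP => -[i _ H]; exists (pickle (n, i)) => //.
  by rewrite /c' pickleK.
rewrite /c'; case: unpickle => [[k i]|] H.
  by exists k => //; rewrite cP; exists i.
by exists 0%N => //; rewrite cP; exists 0%N.
Qed.

Lemma compact_sub_block (x0 : X) A : compact A -> exists2 B, block B & A `<=` B.
Proof.
move=> cA.
have /choice[B BP] : forall x, exists B, block B /\ B x.
  by move=> x; have [B] := block_ex x; exists B.
have [] := compact_finite_subcover (f := B) cA.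
- by move=> x; apply: saturated_open; case: (BP x) => -[].
- by move=> x _; exists x => //; case: (BP x).
move=> s As; exists (\bigcup_n B (nth x0 s n)).
  by apply: block_bigcup => n; case: (BP (nth x0 s n)).
by move=> x /As[i /= /(nthP x0)[n _ <-] Bx]; exists n.
Qed.

Lemma sigma_compact_sub_block (x0 : X) A :
  sigma_compact A -> exists2 B, block B & A `<=` B.
Proof.
move=> [K cK ->].
have /choice[B BP] : forall n, exists B, block B /\ K n `<=` B.
  by move=> n; have [B] := compact_sub_block x0 (cK n); exists B.
exists (\bigcup_n B n); first by apply: block_bigcup => n; case: (BP n).
by apply: subset_bigcup => n _; case: (BP n).
Qed.

Lemma block_sub_sigma_compact B : block B ->
  exists2 A, sigma_compact A & B `<=` A.
Proof.
move=> [_ [c ->]]; exists (\bigcup_n rcball (c n)).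
  by exists (rcball \o c) => // n; exact: rho_compact.
by apply: subset_bigcup => n _ y; apply: ltW.
Qed.

(** The supremum of the tent functions of the balls, the n-th one truncated at
    1/(n+1): only finitely many of them exceed a given positive value, and
    a supremum of 1-Lipschitz functions is 1-Lipschitz. *)
Lemma block_function B : block B -> exists v : X -> R,
  [/\ continuous v, forall x, 0 <= v x <= 1, forall x, B x -> 0 < v x
    & forall e, 0 < e -> compact [set x | e <= v x]].
Proof.
move=> [_ [c ->]].
pose t y n : R := Order.min n.+1%:R^-1 (Order.max 0 (rho (c n) - d (c n) y)).
pose v y := sup (range (t y)).
have t0 y n : 0 <= t y n by rewrite le_min le_max lexx invr_ge0 ler0n.
have t1 y n : t y n <= 1.
  by rewrite ge_min invf_le1 ?ltr0n// ler1n.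
have hs y : has_sup (range (t y)).
  by split; [exists (t y 0%N), 0%N|exists 1 => _ [n _ <-]].
have tv y n : t y n <= v y by apply: ub_le_sup; [case: (hs y)|exists n].
have vlip x y : v x <= v y + d x y.
  apply: ge_sup; first by case: (hs x).
  move=> _ [n _ <-]; have := tv y n; rewrite /t.
  have := dtri x (c n) y; have := dge0 x y.
  move: n.+1%:R^-1 => w; rewrite !minEle !maxEle.
  repeat case: ifPn; rewrite -?ltNge => *; lra.
have vc : continuous v by apply: (lipschitz_continuous dP).
exists v; split=> //.
- move=> x; rewrite (le_trans (t0 x 0%N) (tv _ _)) /=.
  by apply: ge_sup; [case: (hs x)|move=> _ [n _ <-]].
- move=> x [n _ /=]; rewrite /rball /= => h; apply: lt_le_trans (tv x n).
  by rewrite lt_min invr_gt0 ltr0n lt_max subr_gt0 h orbT.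
move=> e e0; pose N := Num.truncn (e / 2)^-1.
have cK : compact (\big[setU/set0]_(n < N.+1) rcball (c n)).
  by apply: bigsetU_compact => n _; apply: rho_compact.
apply: (subclosed_compact _ cK).
  by have := closed_comp (fun y _ => @vc y) (@closed_ge R e); apply.
move=> x /= ev.
have e2 : 0 < e / 2 by lra.
have [_ [n _ <-]] := sup_adherent e2 (hs x).
rewrite -/(v x) => h; have {h} : e / 2 < t x n by lra.
rewrite lt_min => /andP[h1]; rewrite lt_max => /orP[|h2]; first by lra.
rewrite -(bigcup_mkord N.+1 (rcball \o c)); exists n; last by rewrite /rcball /=; lra.
rewrite /= ltnS /N truncn_ge_nat; last by rewrite invr_ge0 ltW.
apply: (@le_trans _ _ n.+1%:R); first by rewrite ler_nat.
by rewrite -[leLHS]invrK lef_pV2 ?posrE ?invr_gt0 ?ltr0n// ltW.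
Qed.

(** The centres of finite covers of the compact balls by balls of radius
    1/(k+1), for all k. *)
Lemma block_dense_seq B : block B ->
  exists D : nat -> X, B `<=` closure (range D).
Proof.
move=> [_ [c ->]].
have net (p : nat * nat) : exists s : seq X,
    rcball (c p.1) `<=` \bigcup_(z in [set` s]) [set y | d z y < p.2.+1%:R^-1].
  apply: compact_finite_subcover; first exact: rho_compact.
    by move=> z; apply: (open_ball dP).
  by move=> z _; exists z => //=; rewrite drefl invr_gt0.
have {net} [F FP] := choice net.
(* all the centres in one sequence; c 0 fills the unused indices *)
pose D n := if @unpickle (nat * nat * nat)%type n is Some (p, i)
  then nth (c 0%N) (F p) i else c 0%N.
exists D => x [n _ /ltW cx] A /dnbhs[e e0 eA].
have [k ke] : exists k, k.+1%:R^-1 < e.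
  exists (Num.truncn e^-1); rewrite -[ltRHS]invrK ltf_pV2 ?posrE ?invr_gt0//.
  by rewrite truncnS_gt.
have [z /= zF zx] := FP (n, k) x cx.
have /(nthP (c 0%N))[i _ iz] := zF.
exists z; split; last by apply: eA; rewrite dsym; apply: lt_trans ke.
by exists (pickle ((n, k), i)) => //; rewrite /D pickleK.
Qed.

End blocks.

(** * Weight above the continuum *)

(** The even places of a binary sequence code a binary sequence, and the odd
    places code a number in unary. *)
Lemma cantor_space_surj_prod_nat :
  exists g : (nat -> bool) -> (nat -> bool) * nat, forall p, exists t, g t = p.
Proof.
exists (fun t : nat -> bool =>
  (fun m => t m.*2, xget 0%N [set n | is_true (t n.*2.+1)])) => -[s n].
exists (fun k => if odd k then k./2 == n else s k./2).
congr pair; first by apply/funext => m; rewrite odd_double doubleK.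
apply: xget_unique => [|m] /=; rewrite odd_double /= uphalf_double// .
by move/eqP.
Qed.

Section weight.
Variables (R : realType) (X : topologicalType) (d : X -> X -> R).
Hypothesis dP : compatible_metric d.

(** The balls of radius 1/(n+1) centred at a dense family form a basis. *)
Lemma dense_cantor_weight (D : (nat -> bool) -> X) :
  closure (range D) = setT -> ~ weight_gt X [set: nat -> bool].
Proof.
move=> Dd [K [[_ Kmin] LK /negP]]; apply.
have [g gs] := cantor_space_surj_prod_nat.
pose b p := [set y | d (D (g p).1) y < (g p).2.+1%:R^-1].
rewrite -/(LK) card_eq_sym card_eq_le LK andbT.
apply: card_le_trans (card_image_le b setT); apply: Kmin.
split=> [_ [p _ <-]|x A /(cm_nbhs dP)[e e0 eA]]; first exact: (open_ball dP).
have [n ne] : exists n, n.+1%:R^-1 < e / 2.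
  exists (Num.truncn (e / 2)^-1).
  rewrite -[ltRHS]invrK ltf_pV2 ?posrE ?invr_gt0//; last by lra.
  exact: truncnS_gt.
have : closure (range D) x by rewrite Dd.
move=> /(_ [set y | d x y < n.+1%:R^-1]) [].
  by apply/(cm_nbhs dP); exists n.+1%:R^-1; rewrite ?invr_gt0.
move=> _ [[s _ <-] /= xs]; have [t gt] := gs (s, n).
exists (b t); first by split; [exists t|rewrite /b gt /= (cm_sym dP)].
move=> y; rewrite /b gt /= => sy; apply: eA.
move: (n.+1%:R^-1) ne xs sy => w ne xs sy.
by have := cm_triangle dP (D s) x y; lra.
Qed.

Variable rho : X -> R.
Hypothesis rho_gt0 : forall x, 0 < rho x.
Hypothesis rho_lip : forall x y, rho x <= rho y + d x y.
Hypothesis rho_compact : forall x, compact [set y | d x y <= rho x].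

Let saturated := saturated d rho.
Let block := block d rho.

(** The classes of the finest partition of X into saturated sets. *)
Definition sat_class x := \bigcap_(B in [set B | saturated B /\ B x]) B.

Lemma sat_class_refl x : sat_class x x.
Proof. by move=> B []. Qed.

Lemma sat_class_saturated x : saturated (sat_class x).
Proof. by apply: saturated_bigcap => B []. Qed.

Lemma sat_class_sub x B : saturated B -> B x -> sat_class x `<=` B.
Proof. by move=> sB Bx y; apply. Qed.

Lemma sat_class_eq x y : sat_class x y -> sat_class x = sat_class y.
Proof.
move=> xy; apply/seteqP; split; apply: sat_class_sub => //;
  try exact: sat_class_saturated.
apply: contrapT => yx.
have sC : saturated (~` sat_class y).
  exact: (saturatedC dP (@sat_class_saturated y)).
by have := sat_class_sub sC yx xy; apply; exact: sat_class_refl.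
Qed.

Lemma block_setU B C : block B -> block C -> block (B `|` C).
Proof.
move=> bB bC; have -> : B `|` C = \bigcup_n (if n is 0%N then B else C).
  apply/seteqP; split=> [x [h|h]|x [[|n] _ h]]; [| |by left|by right].
    by exists 0%N.
  by exists 1%N.
by apply: (@block_bigcup R X d rho) => -[].
Qed.

(** Each class lies in a block, and countably many blocks are covered by one:
    so if no block covers the complement of T, infinitely many classes meet it. *)
Lemma sat_class_dichotomy (x0 : X) (T : set X) :
  (exists2 C, block C & ~` T `<=` C) \/
  exists x : nat -> X, (forall n, ~ T (x n)) /\
    forall m n, sat_class (x m) (x n) -> m = n.
Proof.
have [fS|iS] := pselect (finite_set (sat_class @` (~` T))); [left|right].
  have /choice[b bP] : forall h : set X, exists B, block B /\
      forall x, h = sat_class x -> h `<=` B.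
    move=> h; have [[x hx]|nh] := pselect (exists x, h = sat_class x).
      have [B bB Bx] := block_ex dP rho_gt0 rho_lip rho_compact x.
      exists B; split=> // _ _; rewrite hx; apply: sat_class_sub => //.
      by case: bB.
    have [B bB _] := block_ex dP rho_gt0 rho_lip rho_compact x0.
    by exists B; split=> // x hx; case: nh; exists x.
  have /finite_seqP[s sE] := fS.
  exists (\bigcup_n b (nth set0 s n)).
    by apply: (@block_bigcup R X d rho) => n; case: (bP (nth set0 s n)).
  move=> x nTx; have : [set` s] (sat_class x) by rewrite -sE; exists x.
  move=> /= /(nthP set0)[n _ nx]; exists n => //.
  by have [_ h] := bP (nth set0 s n); apply: (h _ nx); rewrite nx; exact: sat_class_refl.
have /pcard_leP[f] := (infiniteP _).1 iS.
have /choice[x xP] : forall n, exists x, ~ T x /\ sat_class x = f n.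
  by move=> n; have [x nTx fx] := 'funS_f (I : [set: nat] n); exists x.
exists x; split=> [n|m n /sat_class_eq]; first by case: (xP n).
rewrite (xP m).2 (xP n).2 => /inj; apply; exact: mem_set.
Qed.

(** Otherwise X would be the union of at most continuum many blocks, and their
    dense sequences would form a dense family indexed by nat -> bool. *)
Lemma weight_gt_many_classes (F : (nat -> bool) -> set X) :
  weight_gt X [set: nat -> bool] -> (forall s, block (F s)) ->
  exists x : nat -> X, (forall n s, ~ F s (x n)) /\
    forall m n, sat_class (x m) (x n) -> m = n.
Proof.
move=> wX bF.
have [D0 _] := choice (fun s => block_dense_seq dP rho_compact (bF s)).
have [] := sat_class_dichotomy (D0 (fun=> false) 0%N) (\bigcup_s F s); last first.
  by move=> [x [nx xx]]; exists x; split=> // n s Fx; apply: (nx n); exists s.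
move=> [C bC TC]; exfalso; move: wX.
have [D DP] := choice (fun s => block_dense_seq dP rho_compact (bF s)).
have [E EP] := block_dense_seq dP rho_compact bC.
have [g gs] := cantor_space_surj_prod_nat.
pose D' t := if odd (g t).2 then E (g t).2./2 else D (g t).1 (g t).2./2.
apply: (@dense_cantor_weight D').
apply/seteqP; split=> // x _.
have [[s _ Fx]|nFx] := pselect ((\bigcup_s F s) x).
  have := DP s x Fx; apply: closureS => _ [n _ <-].
  have [t gt] := gs (s, n.*2); exists t => //.
  by rewrite /D' gt /= odd_double doubleK.
have := EP x (TC x nFx); apply: closureS => _ [n _ <-].
have [t gt] := gs (fun=> false, n.*2.+1); exists t => //.
by rewrite /D' gt /= odd_double /= uphalf_double.
Qed.

End weight.

(** * The Stone-Cech compactification *)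

Lemma initial_nbhsP (S : choiceType) (T : topologicalType) (f : S -> T)
    (x : initial_topology f) (A : set S) :
  nbhs x A <-> exists2 B, nbhs (f x) B & f @^-1` B `<=` A.
Proof.
split=> [|[B fB BA]].
  rewrite nbhsE => -[_ [[B oB <-] Bx] BA]; exists B => //.
  by exists B.
by apply: (filterS BA); exact: (@initial_continuous S T f x B fB).
Qed.

Lemma set_type_nbhsP (T : topologicalType) (A : set T) (x : set_type A)
    (B : set (set_type A)) :
  nbhs x B <-> exists2 C, nbhs (set_val x) C & set_val @^-1` C `<=` B.
Proof. exact: initial_nbhsP. Qed.

Lemma compact_set_type (T : topologicalType) (A : set T) (B : set (set_type A)) :
  compact (set_val @` B) -> compact B.
Proof.
move=> cA F PF FB.
have [|_ [[x Bx <-] xF]] := cA (set_val @ F) _.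
  by apply: (@filterS _ F _ _ _ _ FB) => x Bx; exists x.
exists x; split=> // C D FC /set_type_nbhsP[E xE ED].
have [|_ [[z Cz <-] Ez]] := xF (set_val @` C) E _ xE.
  by apply: (@filterS _ F _ _ _ _ FC) => z Cz; exists z.
by exists z; split=> //; apply: ED.
Qed.

Lemma set_val_hausdorff (T : topologicalType) (A : set T) :
  hausdorff_space T -> hausdorff_space (set_type A).
Proof.
move=> hT x y xy; apply: val_inj; rewrite -!set_valE; apply: hT => B C xB yC.
have [||z [zB zC]] := xy (set_val @^-1` B) (set_val @^-1` C).
- by apply/set_type_nbhsP; exists B.
- by apply/set_type_nbhsP; exists C.
by exists (set_val z).
Qed.

Section stone_cech_theory.
Variables (R : realType) (X : topologicalType).

Local Notation bX := (stone_cech R X).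
Local Notation e := (@stone_cech_in R X).
Local Notation unit_map := (@unit_interval_maps R X).

(** The extension to the compactification of a map into the unit interval
    is the corresponding coordinate projection. *)
Definition sc_ext (f : X -> R) (q : bX) : R :=
  if pselect (unit_map f) is left fP then
    (set_val q : forall g : set_type unit_map, R) (SigSub (mem_set fP)) else 0.

Lemma sc_ext_in f x : unit_map f -> sc_ext f (e x) = f x.
Proof. by move=> fP; rewrite /sc_ext; case: pselect. Qed.

Lemma sc_val_continuous : continuous (set_val : bX -> _).
Proof. exact: initial_continuous. Qed.

Lemma sc_ext_continuous f : continuous (sc_ext f).
Proof.
rewrite /sc_ext; case: pselect => [fP|_] q; last exact: cst_continuous.
apply: (@continuous_comp _ _ _ (set_val : bX -> _)
  (fun p => p (SigSub (mem_set fP)))); first exact: sc_val_continuous.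
exact: proj_continuous.
Qed.

Lemma stone_cech_in_continuous : continuous e.
Proof.
move=> x A /set_type_nbhsP[B]; rewrite nbhs_simpl /= => xB BA.
suff h : nbhs x (@eval_map R X @^-1` B).
  by apply: (filterS _ h) => y By; exact: (BA (e y) By).
suff {A B xB BA} : @eval_map R X @ x --> @eval_map R X x by apply.
apply/cvg_sup => f B /initial_nbhsP[C fC CB].
have [cf _] := set_valP f.
have xC : nbhs x (set_val f @^-1` C) by exact: cf fC.
by apply: (@filterS _ (nbhs x) _ _ _ _ xC) => y Cy; exact: (CB (eval_map y)).
Qed.

Lemma stone_cech_dense : closure (range e) = setT.
Proof.
apply/seteqP; split=> // q _ A /set_type_nbhsP[B qB BA].
have [_ [[x _ <-] Bx]] := set_valP q B qB.
by exists (e x); split; [exists x|apply: BA].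
Qed.

Lemma stone_cech_hausdorff : hausdorff_space bX.
Proof.
by apply: set_val_hausdorff; apply: hausdorff_product => f; exact: Rhausdorff.
Qed.

Lemma stone_cech_compact : compact [set: bX].
Proof.
apply: compact_set_type; rewrite (_ : _ @` _ = closure (range (@eval_map R X)));
  last first.
  apply/seteqP; split=> [_ [q _ <-]|p Ap]; first exact: set_valP.
  by exists (SigSub (mem_set Ap)).
pose cube : set {ptws set_type unit_map -> R} :=
  [set p | forall f, `[0, 1]%classic (p f)].
have ccube : compact cube.
  by apply: (@tychonoff _ (fun _ : set_type unit_map => (R : topologicalType))
    (fun _ => `[0, 1]%classic)) => f; exact: segment_compact.
apply: (subclosed_compact _ ccube); first exact: closed_closure.
have ccl : closed cube.
  by apply: compact_closed ccube; apply: hausdorff_product => f; exact: Rhausdorff.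
rewrite [X in _ `<=` X]((closure_id _).1 ccl); apply: closureS => _ [x _ <-] f.
by have [_ /(_ x)] := set_valP f; rewrite /= in_itv.
Qed.

(** As X is dense, an open set is known, up to closure, from its trace on X. *)
Lemma stone_cech_open_closure (O : set bX) :
  open O -> O `<=` closure (e @` (e @^-1` O)).
Proof.
move=> oO q Oq A qA; have : closure (range e) q by rewrite stone_cech_dense.
move=> /(_ (O `&` A)) [|_ [[x _ <-] [Ox Ax]]].
  by apply: filterI => //; apply: open_nbhs_nbhs.
by exists (e x); split=> //; exists x.
Qed.

Lemma sc_ext_closed_le f r : closed [set q | sc_ext f q <= r].
Proof.
by have := closed_comp (fun q _ => @sc_ext_continuous f q) (@closed_le R r); apply.
Qed.

Lemma sc_ext_closed_ge f r : closed [set q | r <= sc_ext f q].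
Proof.
by have := closed_comp (fun q _ => @sc_ext_continuous f q) (@closed_ge R r); apply.
Qed.

Lemma sc_ext_open_lt f r : open [set q | sc_ext f q < r].
Proof.
by have := open_comp (fun q _ => @sc_ext_continuous f q) (@open_lt R r); apply.
Qed.

Lemma sc_ext_open_gt f r : open [set q | r < sc_ext f q].
Proof.
by have := open_comp (fun q _ => @sc_ext_continuous f q) (@open_gt R r); apply.
Qed.

Lemma sc_ext_closure_le f (A : set X) r q : unit_map f ->
  (forall x, A x -> f x <= r) -> closure (e @` A) q -> sc_ext f q <= r.
Proof.
move=> fu fr qA; apply: (sc_ext_closed_le (r := r)).
by apply: closureS qA => _ [x Ax <-] /=; rewrite sc_ext_in// fr.
Qed.

Lemma sc_ext_closure_ge f (A : set X) r q : unit_map f ->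
  (forall x, A x -> r <= f x) -> closure (e @` A) q -> r <= sc_ext f q.
Proof.
move=> fu fr qA; apply: (sc_ext_closed_ge (r := r)).
by apply: closureS qA => _ [x Ax <-] /=; rewrite sc_ext_in// fr.
Qed.

Lemma sc_ext_lt_closure f r q : unit_map f ->
  sc_ext f q < r -> closure (e @` [set x | f x < r]) q.
Proof.
move=> fu qr; have := stone_cech_open_closure (@sc_ext_open_lt f r) qr.
by apply: closureS => _ [x /= + <-]; rewrite sc_ext_in// => h; exists x.
Qed.

Lemma sc_ext_itv f q : unit_map f -> 0 <= sc_ext f q <= 1.
Proof.
move=> fu; have qT : closure (range e) q by rewrite stone_cech_dense.
by apply/andP; split; [apply: (sc_ext_closure_ge fu _ qT)|
  apply: (sc_ext_closure_le fu _ qT)] => x _; case: fu => _ /(_ x)/andP[].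
Qed.

Definition indic_map (B : set X) (x : X) : R := if pselect (B x) then 1 else 0.

Lemma clopen_unit_map B : clopen B -> unit_map (indic_map B).
Proof.
move=> [oB cB]; split=> x; last first.
  by rewrite /indic_map; case: pselect => ?; rewrite ?lexx ler01.
move=> A /nbhs_singleton Ax.
suff : nbhs x [set y | indic_map B y = indic_map B x].
  by apply: filterS => y /= yx; rewrite /= yx.
have [Bx|Bx] := pselect (B x).
  have h : nbhs x B by exact: open_nbhs_nbhs.
  by apply: (filterS _ h) => y By; rewrite /= /indic_map;
    case: (pselect (B y)) => // ?; case: (pselect (B x)).
have h : nbhs x (~` B) by apply: open_nbhs_nbhs; split => //; exact: closed_openC.
by apply: (filterS _ h) => y By; rewrite /= /indic_map;
    case: (pselect (B y)) => // ?; case: (pselect (B x)).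
Qed.

(** The indicator function of B takes the values 0 and 1 only, hence so does its
    extension; any threshold in between cuts out the closure of B. *)
Lemma clopen_closureP B q : clopen B ->
  closure (e @` B) q <-> 1 / 2 < sc_ext (indic_map B) q.
Proof.
move=> cB; have fu := clopen_unit_map cB; split=> [qB|qB].
  apply: (@lt_le_trans _ _ 1); first by lra.
  by apply: (sc_ext_closure_ge fu _ qB) => x Bx; rewrite /indic_map; case: pselect.
have := stone_cech_open_closure (@sc_ext_open_gt (indic_map B) (1/2)) qB.
apply: closureS => _ [x /= + <-]; rewrite sc_ext_in// /indic_map.
by case: pselect => [Bx _|? h]; [exists x|exfalso; move: h => /=; lra].
Qed.

Lemma clopen_closure_open B : clopen B -> open (closure (e @` B)).
Proof.
move=> cB; rewrite (_ : closure _ = [set q | 1 / 2 < sc_ext (indic_map B) q]).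
  exact: sc_ext_open_gt.
by apply/seteqP; split=> q /(clopen_closureP _ cB).
Qed.

Lemma clopen_closure_disjoint A B q : clopen B -> A `&` B = set0 ->
  closure (e @` A) q -> ~ closure (e @` B) q.
Proof.
move=> cB AB qA /(clopen_closureP _ cB).
have : sc_ext (indic_map B) q <= 0; last by lra.
apply: (sc_ext_closure_le (clopen_unit_map cB) _ qA) => x Ax.
rewrite /indic_map; case: pselect => // Bx.
by have : (A `&` B) x by []; rewrite AB.
Qed.

End stone_cech_theory.

Section stone_cech_metrizable.
Variables (R : realType) (X : topologicalType) (d : X -> X -> R).
Hypothesis dP : compatible_metric d.

Local Notation bX := (stone_cech R X).
Local Notation e := (@stone_cech_in R X).

Lemma unit_bump x r : 0 < r ->
  unit_interval_maps (fun y => Order.min 1 (d x y / r)).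
Proof.
move=> r0; split=> y.
  apply: (@continuous_min R X (fun=> 1) (fun y => d x y / r) y); first exact: cvg_cst.
  by apply: cvgMl; exact: (dist_continuous dP).
by rewrite le_min ler01 ge_min lexx divr_ge0 ?(cm_ge0 dP)// ltW.
Qed.

(** The distance to x, rescaled and truncated, separates x from a set to which it is not
    adherent: X is a subspace of its compactification. *)
Lemma stone_cech_in_closure (A : set X) x :
  closure (e @` A) (e x) -> closure A x.
Proof.
move=> xA B /(cm_nbhs dP)[r r0 rB]; apply: contrapT => AB.
have fu := unit_bump x r0.
have : 1 <= sc_ext (fun y => Order.min 1 (d x y / r)) (e x).
  apply: (sc_ext_closure_ge fu _ xA) => y Ay.
  rewrite le_min lexx ler_pdivlMr// mul1r leNgt; apply/negP => yr.
  by apply: AB; exists y; split=> //; apply: rB.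
by rewrite sc_ext_in// (cm_refl dP) mul0r le_min ler10 andbF.
Qed.

Lemma stone_cech_in_compact (A : set X) : compact A -> closed (e @` A).
Proof.
move=> cA; apply: compact_closed; first exact: stone_cech_hausdorff.
by apply: continuous_compact cA; apply: continuous_subspaceT;
  exact: stone_cech_in_continuous.
Qed.

Lemma compact_stone_cech_in (C : set bX) :
  closed C -> C `<=` range e -> compact (e @^-1` C).
Proof.
move=> cC Ce F PF FC.
have cptC : compact C.
  by apply: (subclosed_compact cC (@stone_cech_compact R X)).
have [|q [Cq qF]] := cptC (e @ F) _; first by [].
have [x _ xq] := Ce q Cq.
exists x; split; first by rewrite /= xq.
rewrite clusterE => A FA; apply: stone_cech_in_closure; rewrite xq.
rewrite clusterE in qF; apply: qF.
by apply: (@filterS _ F _ _ _ _ FA) => y Ay; exists y.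
Qed.

Hypothesis lcX : locally_compact [set: X].

(** Near a point x with a compact neighborhood C, the compactification adds
    nothing: the points where the extended distance to x is small belong to the
    closure of C, and C, being compact, is already closed. *)
Lemma stone_cech_in_open : open (range e).
Proof.
rewrite openE => _ [x _ <-].
have [C] := lcX (I : [set: X] x); rewrite withinET => xC [cC _].
have {}xC : nbhs x C by apply: filterS xC => y; apply.
have [r r0 rC] := (cm_nbhs dP x C).1 xC.
have fu := unit_bump x r0; set f := fun y => _ in fu.
apply: (@filterS _ _ _ [set q | sc_ext f q < 1]).
  move=> q /(sc_ext_lt_closure fu) qf.
  have : closure (e @` C) q.
    apply: closureS qf => _ [y + <-]; rewrite /f /= gt_min ltxx /=.
    by rewrite ltr_pdivrMr// mul1r => yr; exists y => //; apply: rC.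
  rewrite -((closure_id _).1 (stone_cech_in_compact cC)).
  by move=> [y _ <-]; exists y.
apply: open_nbhs_nbhs; split; first exact: sc_ext_open_lt.
by rewrite /= sc_ext_in// /f (cm_refl dP) mul0r gt_min ltr01 orbT.
Qed.

End stone_cech_metrizable.

(** * Traces of one-point extensions *)

Lemma compact_pos_lower_bound (R : realType) (T : topologicalType) (C : set T)
    (f : T -> R) :
  compact C -> continuous f -> (forall q, C q -> 0 < f q) ->
  exists2 r, 0 < r & forall q, C q -> r <= f q.
Proof.
move=> cC cf f0.
have [] := compact_finite_subcover (f := fun n : nat => [set q | n.+1%:R^-1 < f q]) cC.
- move=> n; have := open_comp (fun q _ => @cf q) (@open_gt R n.+1%:R^-1); apply.
- move=> q /f0 fq; exists (Num.truncn (f q)^-1) => //=.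
  rewrite -[ltRHS]invrK ltf_pV2 ?posrE ?invr_gt0//; exact: truncnS_gt.
move=> s sP; exists (\max_(n <- s) n).+1%:R^-1; first by rewrite invr_gt0.
move=> q /sP[n /= ns /ltW]; apply: le_trans.
by rewrite lef_pV2 ?posrE ?ltr0n// ler_nat ltnS leq_bigmax_seq.
Qed.

Section sc_ext_zero.
Variables (R : realType) (X : topologicalType).
Local Notation bX := (stone_cech R X).
Local Notation e := (@stone_cech_in R X).

Lemma sc_ext_zero_sub (f g : X -> R) :
  unit_interval_maps f -> unit_interval_maps g ->
  (forall r, 0 < r -> exists2 s, 0 < s & forall x, f x < s -> g x <= r) ->
  [set q : bX | sc_ext f q = 0] `<=` [set q | sc_ext g q = 0].
Proof.
move=> fu gu fg q /= fq.
apply/eqP; rewrite eq_le; have /andP[-> _] := sc_ext_itv q gu; rewrite andbT.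
apply/ler_addgt0Pl => r r0; rewrite addr0.
have [s s0 sP] := fg r r0.
have : sc_ext f q < s by rewrite fq.
by move=> /(sc_ext_lt_closure fu); apply: sc_ext_closure_le.
Qed.

(** The compactification is Hausdorff and X is dense in it. *)
Lemma sc_ext_unique (f : X -> R) (phi : bX -> R) : unit_interval_maps f ->
  continuous phi -> (forall x, phi (e x) = f x) -> forall q, sc_ext f q = phi q.
Proof.
move=> fu cphi phie q; apply/eqP; rewrite -subr_eq0; apply/eqP.
have cdiff : continuous (fun q => sc_ext f q - phi q).
  by move=> p; exact: (cvgB (@sc_ext_continuous R X f p) (cphi p)).
have cl : closed [set p | sc_ext f p - phi p = 0].
  by have := closed_comp (fun p _ => @cdiff p) (@closed_eq R 0); apply.
have : closure (range e) q by rewrite stone_cech_dense.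
move=> h; apply: cl; apply: closureS h => _ [x _ <-] /=.
by rewrite sc_ext_in// phie subrr.
Qed.

End sc_ext_zero.

Section traces.
Variables (R : realType) (X : topologicalType).
Implicit Types Y : one_point_ext R X.

Local Notation bX := (stone_cech R X).
Local Notation e := (@stone_cech_in R X).

Definition ext_dist Y : Y -> Y -> R :=
  projT1 (cid (metrizable_compatible (ext_metrizable Y))).

Lemma ext_distP Y : compatible_metric (@ext_dist Y).
Proof. exact: (projT2 (cid (metrizable_compatible (ext_metrizable Y)))). Qed.

Definition ext_pt Y : Y := None.

Lemma ext_in_continuous Y : continuous (ext_in Y).
Proof.
apply/continuousP => A oA; have [_ ->] := ext_embedding Y.
by exists A.
Qed.

(** X is open in the extension, not just a subspace, since points are closed. *)
Lemma ext_in_nbhs Y x (A : set Y) :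
  nbhs (ext_in Y x) A <-> nbhs x (ext_in Y @^-1` A).
Proof.
split=> [|xA]; first exact: ext_in_continuous.
move: xA; rewrite nbhsE => -[U [oU Ux] UA].
have : [set Some @^-1` B | B in @open Y] U by rewrite -(ext_embedding Y).2.
move=> [B oB BU].
have cl : closed [set ext_pt Y].
  apply: accessible_closed_set1; apply: hausdorff_accessible.
  exact: cm_hausdorff (ext_distP Y).
have h : nbhs (ext_in Y x) (B `&` ~` [set ext_pt Y]).
  apply: open_nbhs_nbhs; split; first by apply: openI => //; exact: closed_openC.
  by split=> //; move: Ux; rewrite -BU.
apply: (filterS _ h) => -[y|] [By nb]; last by case: nb.
by apply: UA; rewrite -BU.
Qed.

Definition ext_gauge Y x : R := Order.min 1 (ext_dist (ext_pt Y) (ext_in Y x)).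

Lemma ext_gauge_unit Y : unit_interval_maps (ext_gauge Y).
Proof.
split=> x; last by rewrite le_min ler01 ge_min lexx (cm_ge0 (ext_distP Y)).
apply: (@continuous_min R X (fun=> 1) (fun y => ext_dist (ext_pt Y) (ext_in Y y)) x).
  exact: cvg_cst.
apply: continuous_comp; first exact: ext_in_continuous.
exact: (dist_continuous (ext_distP Y)).
Qed.

Lemma ext_gauge_gt0 Y x : 0 < ext_gauge Y x.
Proof. by rewrite lt_min ltr01; apply: (cm_gt0 (ext_distP Y)). Qed.

Lemma ext_nbhs_pt Y (A : set Y) : nbhs (ext_pt Y) A <->
  A (ext_pt Y) /\ exists2 r, 0 < r & forall x, ext_gauge Y x < r -> A (ext_in Y x).
Proof.
have nbP := cm_nbhs (ext_distP Y) (ext_pt Y) A.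
split=> [/nbP[r r0 rA]|[A0 [r r0 rA]]].
  split; first by apply: rA; rewrite (cm_refl (ext_distP Y)).
  exists (Order.min r 1); first by rewrite lt_min r0 ltr01.
  move=> x; rewrite gt_min !lt_min ltxx andbF /= => /andP[h _]; exact: rA.
apply/nbP; exists r => // -[x|] h //; apply: rA.
by rewrite gt_min; apply/orP; right.
Qed.

Lemma ext_gauge_small Y r : 0 < r -> exists x, ext_gauge Y x < r.
Proof.
move=> r0; have : nbhs (ext_pt Y) (ext_pt Y |` (ext_in Y @` [set x | ext_gauge Y x < r])).
  by apply/ext_nbhs_pt; split; [left|exists r => // x xr; right; exists x].
rewrite nbhsE => -[B [oB B0] BP].
have [|y [By [x _ xy]]] := @ext_dense R X Y B _ oB; first by exists (ext_pt Y).
have := BP y By; rewrite -xy => -[//|[z zr _]]; by exists z.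
Qed.

(** The intersection of the closures in the compactification of the punctured
    neighborhoods of the added point, written as a zero set. *)
Definition ext_trace Y : set bX := [set q | sc_ext (ext_gauge Y) q = 0].

(** Any function that measures the neighborhoods of the added point can replace
    the distance to that point. *)
Lemma ext_traceP Y (g : X -> R) : unit_interval_maps g ->
  (forall A : set Y, nbhs (ext_pt Y) A <-> A (ext_pt Y) /\
    exists2 r, 0 < r & forall x, g x < r -> A (ext_in Y x)) ->
  ext_trace Y = [set q | sc_ext g q = 0].
Proof.
move=> gu gP; apply/seteqP; split; apply: sc_ext_zero_sub => //;
  try exact: ext_gauge_unit; move=> r r0.
  have /ext_nbhs_pt[_ [s s0 sP]] :
      nbhs (ext_pt Y) (ext_pt Y |` (ext_in Y @` [set x | g x < r])).
    by apply/gP; split; [left|exists r => // x xr; right; exists x].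
  by exists s => // x /sP[//|[y yr [yx]]]; rewrite -yx ltW.
have /gP[_ [s s0 sP]] :
    nbhs (ext_pt Y) (ext_pt Y |` (ext_in Y @` [set x | ext_gauge Y x < r])).
  by apply/ext_nbhs_pt; split; [left|exists r => // x xr; right; exists x].
by exists s => // x /sP[//|[y yr [yx]]]; rewrite -yx ltW.
Qed.

(** A map over X sends the added point to the added point, as X is dense and
    the extensions are Hausdorff. *)
Lemma ext_map_pt Y1 Y2 (h : Y2 -> Y1) : continuous h ->
  (forall x, h (ext_in Y2 x) = ext_in Y1 x) -> h (ext_pt Y2) = ext_pt Y1.
Proof.
move=> ch hX; case E : (h (ext_pt Y2)) => [x0|//]; exfalso.
have ne : ext_in Y2 x0 <> ext_pt Y2 by [].
apply: ne; apply: (cm_hausdorff (ext_distP Y2)) => A B xA pB.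
have h1 : nbhs (ext_in Y1 x0) (ext_in Y1 @` (ext_in Y2 @^-1` A)).
  apply/ext_in_nbhs; move/ext_in_nbhs: xA; apply: filterS => x Ax.
  by exists x.
have h2 : nbhs (ext_pt Y2) (h @^-1` (ext_in Y1 @` (ext_in Y2 @^-1` A))).
  by apply: (ch (ext_pt Y2)); rewrite E.
have h3 := @filterI _ _ (nbhs_filter (ext_pt Y2)) _ _ h2 pB.
have [_ [r r0 rP]] := (ext_nbhs_pt _).1 h3.
have [x /rP[[y Ay]]] := ext_gauge_small Y2 r0.
by rewrite hX => -[yx] Bx; exists (ext_in Y2 x); split=> //; rewrite -yx.
Qed.

Lemma ext_le_trace Y1 Y2 : ext_le Y1 Y2 -> ext_trace Y2 `<=` ext_trace Y1.
Proof.
move=> [h ch hX]; apply: sc_ext_zero_sub => [||r r0]; try exact: ext_gauge_unit.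
have : nbhs (ext_pt Y1) (ext_pt Y1 |` (ext_in Y1 @` [set x | ext_gauge Y1 x < r])).
  by apply/ext_nbhs_pt; split; [left|exists r => // x xr; right; exists x].
rewrite -(ext_map_pt ch hX) => /ch /ext_nbhs_pt[_ [s s0 sP]].
exists s => // x /sP /=; rewrite hX (ext_map_pt ch hX) => -[//|[y yr [yx]]].
by rewrite -yx ltW.
Qed.

(** Where the gauge of Y1 is at least r, that of Y2 does not vanish, so by
    compactness it is at least some s > 0: every neighborhood of the point added
    in Y1 contains one of the point added in Y2. *)
Lemma ext_trace_id_continuous Y1 Y2 : ext_trace Y2 `<=` ext_trace Y1 ->
  continuous ((fun y : option X => y) : Y2 -> Y1).
Proof.
move=> tr [x|] A yA; first by apply/ext_in_nbhs; move/ext_in_nbhs: yA.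
have [A0 [r r0 rA]] := (ext_nbhs_pt _).1 yA.
apply/ext_nbhs_pt; split=> //.
pose C := [set q | r <= sc_ext (ext_gauge Y1) q].
have cC : compact C.
  exact: subclosed_compact (@sc_ext_closed_ge _ _ _ _) (@stone_cech_compact R X) _.
have [q|s s0 sP] := compact_pos_lower_bound cC (@sc_ext_continuous _ _ (ext_gauge Y2)).
  rewrite /C /= => rq; rewrite lt_neqAle.
  have /andP[-> _] := sc_ext_itv q (ext_gauge_unit Y2).
  rewrite andbT; apply/eqP => q0; have /tr : ext_trace Y2 q by [].
  by rewrite /ext_trace /= => q1; move: rq; rewrite q1 leNgt r0.
exists s => // x xs; apply: rA; rewrite ltNge; apply/negP => rx.
have /sP : C (e x) by rewrite /C /= sc_ext_in//; exact: ext_gauge_unit.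
by rewrite sc_ext_in ?leNgt ?xs//; exact: ext_gauge_unit.
Qed.

Lemma ext_leP Y1 Y2 : ext_le Y1 Y2 <-> ext_trace Y2 `<=` ext_trace Y1.
Proof.
split; first exact: ext_le_trace.
by move=> /ext_trace_id_continuous cid; exists (fun y : option X => y).
Qed.

Lemma ext_equivP Y1 Y2 : ext_equiv Y1 Y2 <-> ext_trace Y1 = ext_trace Y2.
Proof.
split=> [[h [ch [k [ck hk kh]]] hX]|tr].
  apply/seteqP; split; apply: ext_le_trace; first by exists h.
  by exists k => // x; rewrite -hX hk.
exists (fun y : option X => y) => //; split.
  by apply: ext_trace_id_continuous; rewrite tr.
exists (fun y : option X => y); split=> //.
by apply: ext_trace_id_continuous; rewrite tr.
Qed.

End traces.

(** * Locally compact extensions and compact open subsets of the remainder *)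

Definition compact_open_remainder (R : realType) (X : topologicalType)
    (K : set (stone_cech R X)) :=
  [/\ closed K, K !=set0 & exists2 O, open O &
    K = (@sigma_set R X `\` range (@stone_cech_in R X)) `&` O].

Section locally_compact_trace.
Variables (R : realType) (X : topologicalType).
Local Notation bX := (stone_cech R X).
Local Notation e := (@stone_cech_in R X).
Implicit Types Y : one_point_ext R X.

(** A shell is a closed part, away from the added point, of a compact
    neighborhood of that point. *)
Lemma ext_gauge_shell_compact Y : locally_compact [set: Y] ->
  exists2 r, 0 < r & forall s, 0 < s ->
    compact [set x | s <= ext_gauge Y x <= r].
Proof.
move=> lcY.
have [C] := lcY (ext_pt Y) (I : [set: Y] _); rewrite withinET => pC [cC _].
have {}pC : nbhs (ext_pt Y) C by apply: filterS pC => y; apply.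
have [_ [r r0 rC]] := (ext_nbhs_pt _).1 pC.
exists (r / 2); first by lra.
move=> s s0 F PF Fs.
have [|y [Cy Fy]] := cC (ext_in Y @ F) _.
  apply: (@filterS _ F _ _ _ _ Fs) => x /= /andP[_ xr]; apply: rC; lra.
case: y Cy Fy => [x|] Cx Fx; last first.
  have [//||_ [[x /= /andP[sx _] <-]]] :=
      Fx (ext_in Y @` [set x | s <= ext_gauge Y x <= r / 2])
         (ext_pt Y |` (ext_in Y @` [set x | ext_gauge Y x < s])).
  - by apply: (@filterS _ F _ _ _ _ Fs) => x xs; exists x.
  - by apply/ext_nbhs_pt; split; [left|exists s => // x xr; right; exists x].
  - by move=> [//|[z /= zs [zx]]]; move: sx; rewrite -zx leNgt zs.
have Fx' : cluster F x.
  move=> A B FA xB.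
  have [|| _ [[z Az <-] [w Bw [wz]]]] := Fx (ext_in Y @` A) (ext_in Y @` B).
  - by apply: (@filterS _ F _ _ _ _ FA) => z Az; exists z.
  - by apply/ext_in_nbhs; apply: filterS xB => z Bz; exists z.
  - by exists z; split=> //; rewrite -wz.
exists x; split=> //.
have [gc _] := ext_gauge_unit Y.
have cl : closed [set x | s <= ext_gauge Y x <= r / 2].
  rewrite (_ : mkset _ = [set x | s <= ext_gauge Y x] `&`
      [set x | ext_gauge Y x <= r / 2]).
    by apply: closedI; [have := closed_comp (fun x _ => @gc x) (@closed_ge R s)
      |have := closed_comp (fun x _ => @gc x) (@closed_le R (r / 2))]; apply.
  by apply/seteqP; split=> z /=; [move/andP|move=> zP; apply/andP].
by apply: cl => B xB; exact: Fx'.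
Qed.

Lemma ext_trace_disjoint Y q : ext_trace Y q -> ~ range e q.
Proof.
rewrite /ext_trace /= => q0 [x _ xq]; move: q0; rewrite -xq sc_ext_in.
  by move=> h; have := ext_gauge_gt0 Y x; rewrite h ltxx.
exact: ext_gauge_unit.
Qed.

Lemma ext_trace_closed Y : closed (ext_trace Y).
Proof.
by have := closed_comp (fun q _ => @sc_ext_continuous R X (ext_gauge Y) q)
  (@closed_eq R 0); apply.
Qed.

Lemma ext_trace_nonempty Y : ext_trace Y !=set0.
Proof.
apply: contrapT => /nonemptyPn tr0.
have gu := ext_gauge_unit Y.
have [q _|r r0 rP] := compact_pos_lower_bound (@stone_cech_compact R X)
    (@sc_ext_continuous _ _ (ext_gauge Y)).
  rewrite lt_neqAle; have /andP[-> _] := sc_ext_itv q gu; rewrite andbT.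
  by apply/eqP => /esym q0; have : ext_trace Y q by []; rewrite tr0.
have [x] := ext_gauge_small Y r0.
by have := rP (e x) I; rewrite sc_ext_in// leNgt => /negP.
Qed.

Lemma sc_ext_mid_closure (f : X -> R) s r q : unit_interval_maps f ->
  s < sc_ext f q -> sc_ext f q < r -> closure (e @` [set x | s <= f x <= r]) q.
Proof.
move=> fu sq qr.
have oO : open ([set q | s < sc_ext f q] `&` [set q | sc_ext f q < r]).
  by apply: openI; [exact: sc_ext_open_gt|exact: sc_ext_open_lt].
have := stone_cech_open_closure oO (conj sq qr).
apply: closureS => _ [x /= [+ +] <-]; rewrite sc_ext_in// => sx xr.
by exists x => //=; rewrite !ltW.
Qed.

(** In a locally compact extension the shells s <= g <= r of the gauge g are
    compact. Hence a point of the compactification where the extension of g is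
    small but nonzero already lies in X, so the zero set is open in the
    remainder; and the punctured neighbourhood g <= r is sigma-compact. *)
Lemma ext_trace_locally_compact Y : locally_compact [set: Y] ->
  compact_open_remainder (ext_trace Y).
Proof.
move=> /ext_gauge_shell_compact[r r0 rP]; have gu := ext_gauge_unit Y.
split; [exact: ext_trace_closed|exact: ext_trace_nonempty|].
exists [set q | sc_ext (ext_gauge Y) q < r]; first exact: sc_ext_open_lt.
apply/seteqP; split=> [q qt|q [[_ qX] /= qr]]; last first.
  apply: contrapT => /eqP q0; apply: qX.
  have qp : 0 < sc_ext (ext_gauge Y) q.
    by rewrite lt_neqAle eq_sym q0; have /andP[] := sc_ext_itv q gu.
  pose s := sc_ext (ext_gauge Y) q / 2.
  have s0 : 0 < s by rewrite /s; lra.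
  have : closure (e @` [set x | s <= ext_gauge Y x <= r]) q.
    by apply: sc_ext_mid_closure => //; rewrite /s; lra.
  rewrite -((closure_id _).1 (stone_cech_in_compact (rP s s0))).
  by move=> [x _ <-]; exists x.
split; last by rewrite /= qt.
split; last exact: ext_trace_disjoint qt.
exists (\bigcup_n [set x | n.+1%:R^-1 <= ext_gauge Y x <= r]).
  by exists (fun n => [set x | n.+1%:R^-1 <= ext_gauge Y x <= r]) => // n;
    apply: rP; rewrite invr_gt0.
have : sc_ext (ext_gauge Y) q < r by rewrite qt.
move=> /(sc_ext_lt_closure gu); apply: closureS => _ [x /= xr <-].
exists x => //; exists (Num.truncn (ext_gauge Y x)^-1) => //=.
rewrite (ltW xr) andbT -[leRHS]invrK lef_pV2 ?posrE ?invr_gt0 ?ext_gauge_gt0//.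
exact/ltW/truncnS_gt.
Qed.

End locally_compact_trace.

(** * Building an extension from a gauge *)

Section gauge_extension.
Variables (R : realType) (X : topologicalType) (d : X -> X -> R).
Hypothesis dP : compatible_metric d.
Variable g : X -> R.
Hypothesis g_continuous : continuous g.
Hypothesis g_gt0 : forall x, 0 < g x.
Hypothesis g_small : forall r, 0 < r -> exists x, g x < r.

(** The added point is put at distance g x from x, and two points of X may be
    joined through it. Adding |g x - g y| to d makes g 1-Lipschitz without
    changing the topology, which gives the triangle inequality. *)
Definition gauge_dist (p q : option X) : R :=
  match p, q with
  | Some x, Some y => Order.min (d x y + `|g x - g y|) (g x + g y)
  | Some x, None => g x
  | None, Some y => g y
  | None, None => 0
  end.

Let dge0 := cm_ge0 dP.

Lemma gauge_dist_refl p : gauge_dist p p = 0.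
Proof.
case: p => [x|//] /=; rewrite (cm_refl dP) subrr normr0 addr0 min_l//.
by have := g_gt0 x; lra.
Qed.

Lemma gauge_dist_eq0 p q : gauge_dist p q = 0 -> p = q.
Proof.
case: p q => [x|] [y|] //= h; try by have := g_gt0 x; rewrite h ltxx.
  congr Some; apply: (cm_eq0 dP); move: h; rewrite minEle.
  have := dge0 x y; have := normr_ge0 (g x - g y); have := g_gt0 x.
  by have := g_gt0 y; case: ifP => _; lra.
by have := g_gt0 y; rewrite h ltxx.
Qed.

Lemma gauge_dist_sym p q : gauge_dist p q = gauge_dist q p.
Proof.
by case: p q => [x|] [y|] //=; rewrite (cm_sym dP x) distrC (addrC (g x)).
Qed.

Lemma gauge_dist_triangle q p r :
  gauge_dist p r <= gauge_dist p q + gauge_dist q r.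
Proof.
have lip x y : g x <= g y + (d x y + `|g x - g y|).
  by have := ler_norm (g x - g y); have := dge0 x y; lra.
have lip' x y : g y <= g x + (d x y + `|g x - g y|).
  by rewrite distrC (cm_sym dP); exact: lip.
case: p q r => [x|] [y|] [z|] /=.
- have := ler_distD (g y) (g x) (g z); have := cm_triangle dP y x z.
  have := lip x y; have := lip y z; have := lip' x y; have := lip' y z.
  have := g_gt0 x; have := g_gt0 y; have := g_gt0 z.
  rewrite !minEle; move: (`|_|) (`|_|) (`|_|) => u v w.
  by repeat case: ifPn; rewrite -?ltNge => *; lra.
- have := lip x y; have := g_gt0 x; have := g_gt0 y.
  by rewrite minEle; case: ifPn => _ *; lra.
- by rewrite ge_min lexx orbT.
- by rewrite addr0.
- have := lip' y z; have := g_gt0 z; have := g_gt0 y.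
  by rewrite minEle; case: ifPn => _ *; lra.
- by have := g_gt0 y; lra.
- by rewrite add0r.
- by rewrite addr0.
Qed.

Lemma gauge_extension_exists : exists Y : one_point_ext R X,
  forall A : set Y, nbhs (ext_pt Y) A <->
    A (ext_pt Y) /\ exists2 r, 0 < r & forall x, g x < r -> A (ext_in Y x).
Proof.
pose M : metricType R := HB.pack (option X)
  (isMetric.Build R (option X) gauge_dist_refl gauge_dist_eq0 gauge_dist_sym
    gauge_dist_triangle).
have nbM (p : M) A : nbhs p A <->
    exists2 r : R, 0 < r & forall y, gauge_dist p y < r -> A y.
  rewrite -(metricType_numDomainType.filter_from_mdist_nbhs p).
  by split=> -[r r0 H]; exists r.
pose t : Topological (option X) := Topological.class M.
have tM : metrizable R (with_topology t).
  by exists M, id; split=> [x A //|]; exists id; split=> [x A //||].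
have nbS x (A : set M) : nbhs (Some x : M) A <-> nbhs x (Some @^-1` A).
  split=> [/nbM[r r0 rA]|/(cm_nbhs dP)[r r0 rA]].
    have h : nbhs x ([set y | d x y < r / 2] `&` [set y | `|g x - g y| < r / 2]).
      apply: filterI; first by apply/(cm_nbhs dP); exists (r / 2) => //; lra.
      by have /cvgrPdist_lt := @g_continuous x; apply; lra.
    apply: (filterS _ h) => y [/= h1 h2]; apply: rA => /=.
    by rewrite gt_min; apply/orP; left; lra.
  apply/nbM; exists (Order.min r (g x)); first by rewrite lt_min r0 g_gt0.
  move=> [y|] /=; last by rewrite lt_min ltxx andbF.
  rewrite lt_min !gt_min => /andP[/orP[h _|h1 /orP[h|h]]].
  - by apply: rA; have := normr_ge0 (g x - g y); lra.
  - by apply: rA; have := normr_ge0 (g x - g y); have := g_gt0 y; lra.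
  - by have := g_gt0 y; lra.
have nbN (A : set M) : nbhs (None : M) A <->
    A None /\ exists2 r, 0 < r & forall x, g x < r -> A (Some x).
  split=> [/nbM[r r0 rA]|[A0 [r r0 rA]]].
    by split; [exact: rA|exists r => // x xr; exact: rA].
  by apply/nbM; exists r => // -[x|] //= xr; exact: rA.
have tE : @embedding X (with_topology t) Some.
  split; first by move=> x y [].
  apply/seteqP; split=> [U oU|_ [B oB <-]].
    exists (Some @` U); last by apply/seteqP; split=> [x [y Uy [<-]]|x Ux] //; exists x.
    rewrite (@openE M) => _ [x Ux <-]; apply/nbS.
    by apply: (filterS _ (open_nbhs_nbhs (conj oU Ux))) => y Uy; exists y.
  rewrite openE => x Bx; apply/nbS; exact: (@open_nbhs_nbhs M (Some x) B (conj oB Bx)).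
have tD : @dense (with_topology t) (range Some).
  move=> O [[x|] Ox] oO; first by exists (Some x); split=> //; exists x.
  have /nbN[_ [r r0 rP]] : nbhs (None : M) O.
    exact: (@open_nbhs_nbhs M None O (conj oO Ox)).
  by have [x /rP Ox'] := g_small r0; exists (Some x); split=> //; exists x.
by exists (OnePointExt tM tE tD) => A; exact: nbN.
Qed.

(** Near the added point, the shells being compact, a cluster point of a filter
    is either the added point or a point of one shell. *)
Lemma gauge_extension_locally_compact (Y : one_point_ext R X) (r : R) :
  locally_compact [set: X] ->
  (forall A : set Y, nbhs (ext_pt Y) A <->
    A (ext_pt Y) /\ exists2 r, 0 < r & forall x, g x < r -> A (ext_in Y x)) ->
  0 < r -> (forall s, 0 < s -> compact [set x | s <= g x <= r]) ->
  locally_compact [set: Y].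
Proof.
move=> lcX nbY r0 rP.
have hY : hausdorff_space Y := cm_hausdorff (ext_distP Y).
have cin (K : set X) : compact K -> compact (ext_in Y @` K).
  move=> cK; apply: continuous_compact cK; apply: continuous_subspaceT.
  exact: ext_in_continuous.
have near_cpt (y : Y) (C : set Y) : nbhs y C -> compact C ->
    compact_near (within [set: Y] (nbhs y)).
  move=> yC cC; exists C; last by split=> //; exact: compact_closed.
  by rewrite withinET; apply: (filterS _ yC).
have lc : forall y : Y, compact_near (within [set: Y] (nbhs y)).
  case=> [x|].
    have [C] := lcX x (I : [set: X] x); rewrite withinET => xC [cC _].
    apply: (@near_cpt (ext_in Y x) (ext_in Y @` C)); last exact: cin.
    by apply/ext_in_nbhs; apply: (filterS _ xC) => z Cz; exists z => //; exact: Cz.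
  apply: (@near_cpt (ext_pt Y) (ext_pt Y |` (ext_in Y @` [set x | g x <= r]))).
    by apply/nbY; split; [left|exists r => // x /ltW xr; right; exists x].
  move=> F PF FC; have [clF|nclF] := pselect (cluster F (ext_pt Y)).
    by exists (ext_pt Y); split=> //; left.
  have [A [B [FA pB AB]]] : exists A B, [/\ F A, nbhs (ext_pt Y) B & A `&` B = set0].
    move: nclF => /existsNP[A /existsNP[B]].
    by move=> /not_implyP[FA /not_implyP[pB /nonemptyPn AB]]; exists A, B.
  have [Bp [s s0 sB]] := (nbY B).1 pB.
  have [|y [[x /andP[_ xr] xy] Fy]] := cin _ (rP s s0) F PF.
    apply: (filterS _ (filterI FC FA)) => y [[->|[x xr <-]] Ay].
      by have : (A `&` B) (ext_pt Y) by []; rewrite AB.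
    exists x => //=; rewrite xr andbT leNgt; apply/negP => /sB Bx.
    by have : (A `&` B) (ext_in Y x) by []; rewrite AB.
  by exists y; split=> //; right; exists x.
by move=> y _; exact: lc.
Qed.

End gauge_extension.

(** * Every compact open subset of the remainder is a trace *)

Section realization.
Variables (R : realType) (X : topologicalType) (d : X -> X -> R).
Hypothesis dP : compatible_metric d.
Hypothesis lcX : locally_compact [set: X].
Variable rho : X -> R.
Hypothesis rho_gt0 : forall x, 0 < rho x.
Hypothesis rho_lip : forall x y, rho x <= rho y + d x y.
Hypothesis rho_compact : forall x, compact [set y | d x y <= rho x].
Local Notation bX := (stone_cech R X).
Local Notation e := (@stone_cech_in R X).
Local Notation block := (block d rho).

Lemma block_closure_sigma_set B : block B -> closure (e @` B) `<=` @sigma_set R X.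
Proof.
move=> /(block_sub_sigma_compact rho_compact)[A sA BA] q qB.
by exists A => //; apply: closureS qB; exact: image_subset.
Qed.

Lemma sigma_set_block q : @sigma_set R X q -> exists2 B, block B & closure (e @` B) q.
Proof.
have [_ [[x0 _ _] _]] : range e `&` setT !=set0.
  by have := @stone_cech_dense R X; move=> /seteqP[_ /(_ q I)]; apply; exact: filterT.
move=> [A /(sigma_compact_sub_block dP rho_gt0 rho_lip rho_compact x0)[B bB AB] qA].
by exists B => //; apply: closureS qA; exact: image_subset.
Qed.

Lemma block_clopen B : block B -> clopen B.
Proof. by move=> [sB _]; exact: (saturated_clopen dP rho_gt0 rho_lip). Qed.

(** The closure of a block is open in the compactification, and finitely many
    blocks lie in one block. *)
Lemma compact_sigma_set_block (K : set bX) : K !=set0 -> compact K ->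
  K `<=` @sigma_set R X -> exists2 B, block B & K `<=` closure (e @` B).
Proof.
move=> [q0 Kq0] cK KS.
have [B0 bB0 _] := sigma_set_block (KS q0 Kq0).
have /choice[B BP] : forall q, exists B, block B /\ (K q -> closure (e @` B) q).
  move=> q; have [/KS/sigma_set_block[B bB qB]|nKq] := pselect (K q).
    by exists B.
  by exists B0; split.
have [q|q Kq|s sP] := compact_finite_subcover (f := fun q => closure (e @` B q)) cK.
- by apply: clopen_closure_open; apply: block_clopen; case: (BP q).
- by exists q => //; case: (BP q) => _; apply.
exists (\bigcup_n B (nth q0 s n)).
  by apply: (@block_bigcup R X d rho) => n; case: (BP (nth q0 s n)).
move=> q /sP[p /= /(nthP q0)[n _ <-]]; apply: closureS; apply: image_subset.
by move=> x Bx; exists n.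
Qed.

(** The gauge is max(v, h): the block function v is positive on B and vanishes
    on the remainder of B, while the Urysohn function h cuts out K inside that
    remainder and takes care of the points outside B. *)
Lemma trace_realization (K : set bX) : compact_open_remainder K ->
  exists2 Y : one_point_ext R X, locally_compact [set: Y] & ext_trace Y = K.
Proof.
move=> [clK K0 [O oO KE]].
have cK : compact K by exact: (subclosed_compact clK (@stone_cech_compact R X)).
have KS : K `<=` @sigma_set R X by rewrite KE => q [[]].
have KO : K `<=` O by rewrite KE => q [].
have KX q : K q -> ~ range e q by rewrite KE => -[[]].
have [B bB KB] := compact_sigma_set_block K0 cK KS.
have cB := block_clopen bB.
have [v [cv v01 vB vc]] := block_function dP rho_compact bB.
have vu : unit_interval_maps v by [].
(* F is the outside of B together with the part of the remainder of B that is
   not in K; it is closed because X and the closure of B are open in the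
   compactification and K is open in the remainder *)
pose F : set bX := ~` (closure (e @` B) `&` (range e `|` O)).
have clF : closed F.
  apply: open_closedC; apply: openI; first exact: clopen_closure_open.
  by apply: openU => //; exact: (stone_cech_in_open dP lcX).
have KF : K `&` F = set0.
  apply/seteqP; split=> // q [Kq]; apply; split; first exact: KB.
  by right; exact: KO.
have nbX : normal_space bX.
  by apply: compact_normal; [exact: stone_cech_hausdorff|exact: stone_cech_compact].
have [h [ch h01 hK hF]] := (@uniform_separatorP _ R _ _).1
  ((@normal_separatorP R _).1 nbX _ _ clK clF KF).
have {}h01 q : 0 <= h q <= 1 by have := h01 (h q); rewrite /= in_itv; apply; exists q.
have {}hK q : K q -> h q = 0 by move=> Kq; apply: hK; exists q.
have {}hF q : F q -> h q = 1 by move=> Fq; apply: hF; exists q.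
pose g x := Order.max (v x) (h (e x)).
have ghe x : g x = Order.max (v x) (h (e x)) by [].
have gu : unit_interval_maps g.
  split=> x; last first.
    rewrite /g le_max ge_max; have /andP[-> ->] := v01 x.
    by have /andP[_ ->] := h01 (e x).
  apply: (@continuous_max R X v (h \o e) x); first exact: cv.
  by apply: continuous_comp; [exact: stone_cech_in_continuous|exact: ch].
have extg q : sc_ext g q = Order.max (sc_ext v q) (h q).
  apply: (sc_ext_unique (phi := fun q => Order.max (sc_ext v q) (h q)) gu).
    move=> p; apply: (@continuous_max R bX (sc_ext v) h p); last exact: ch.
    exact: sc_ext_continuous.
  by move=> x; rewrite sc_ext_in.
have g_gt0 x : 0 < g x.
  rewrite /g lt_max; have [Bx|nBx] := pselect (B x); first by rewrite vB.
  rewrite hF ?ltr01 ?orbT// => -[xB _]; apply: nBx.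
  by rewrite ((closure_id _).1 cB.2); exact: (stone_cech_in_closure dP xB).
have extv q : ~ range e q -> sc_ext v q = 0.
  move=> nq; apply/eqP; rewrite eq_le; have /andP[-> _] := sc_ext_itv q vu.
  rewrite andbT leNgt; apply/negP => vq; apply: nq.
  pose s := sc_ext v q / 2; have s0 : 0 < s by rewrite /s; lra.
  have oO' := @sc_ext_open_gt R X v s.
  have sq : s < sc_ext v q by rewrite /s; lra.
  have : closure (e @` [set x | s <= v x]) q.
    have := stone_cech_open_closure oO' sq; apply: closureS => _ [x /= + <-].
    by rewrite sc_ext_in// => /ltW sx; exists x.
  rewrite -((closure_id _).1 (stone_cech_in_compact (vc s s0))).
  by move=> [x _ <-]; exists x.
(* outside of X and K the extension of g is constantly 1 *)
have extg_pos q : ~ K q -> ~ range e q -> sc_ext g q = 1.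
  move=> nKq nq; rewrite extg extv// hF; first by rewrite max_r.
  move=> [qB [//|Oq]]; apply: nKq; rewrite KE; split=> //; split=> //.
  exact: block_closure_sigma_set qB.
have extg0 : [set q | sc_ext g q = 0] = K.
  apply/seteqP; split=> q /= => [q0|Kq]; last first.
    by rewrite extg extv ?hK ?maxxx//; exact: KX.
  apply: contrapT => nKq; have [[x _ xq]|nq] := pselect (range e q).
    by move: q0 (g_gt0 x); rewrite -xq sc_ext_in// => ->; rewrite ltxx.
  by move/eqP: q0; rewrite extg_pos// oner_eq0.
have g_small r : 0 < r -> exists x, g x < r.
  move=> r0; have [q Kq] := K0; have : sc_ext g q < r.
    by move: Kq; rewrite -extg0 /= => ->.
  move=> /(sc_ext_lt_closure gu)/(_ setT filterT)[_ [[x xr _] _]].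
  by exists x.
have [Y YP] := gauge_extension_exists dP gu.1 g_gt0 g_small.
exists Y; last by rewrite (ext_traceP gu YP).
have half0 : 0 < 1 / 2 :> R by lra.
apply: (gauge_extension_locally_compact lcX YP half0) => s s0.
pose C := [set q | s <= sc_ext g q] `&` [set q | sc_ext g q <= 1 / 2].
rewrite (_ : mkset _ = e @^-1` C); last first.
  by apply/seteqP; split=> x; rewrite /C /= sc_ext_in//; [move/andP|move=> ?; apply/andP].
apply: (compact_stone_cech_in dP).
  by apply: closedI; [exact: sc_ext_closed_ge|exact: sc_ext_closed_le].
move=> q [/= sq q2]; apply: contrapT => nq.
have [Kq|nKq] := pselect (K q).
  by move: sq; move: Kq; rewrite -extg0 /= => ->; rewrite leNgt s0.
by move: q2; rewrite extg_pos//; lra.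
Qed.

End realization.

(** * The remainder of the one-point compactification *)

Section remainder.
Variables (R : realType) (X : topologicalType).
Local Notation bX := (stone_cech R X).
Local Notation e := (@stone_cech_in R X).
Local Notation sX := (@sigma_set R X).
Local Notation W := (omega_sigma_remainder R X).

Lemma omega_notin_image : (~` @omega_sigma_image R X) (None : omega_sigma R X).
Proof. by move=> [p _]. Qed.

(** The point Omega. *)
Definition rem_pt : W := SigSub (mem_set omega_notin_image).

(** The points of the remainder other than Omega are copies of points of
    sigma X \ X; this relates w to the point q that it is a copy of. *)
Definition rem_over (w : W) (q : bX) :=
  exists2 p : set_type sX, set_val w = Some p :> omega_sigma R X & set_val p = q.

Definition rem_lift (K : set bX) : set W :=
  [set w | exists2 q, rem_over w q & K q].

Definition rem_proj (G : set W) : set bX :=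
  [set q | exists2 w, rem_over w q & G w].

Lemma rem_over_fun w q q' : rem_over w q -> rem_over w q' -> q = q'.
Proof. by move=> [p wp <-] [p']; rewrite wp => -[<-] <-. Qed.

Lemma rem_over_inj w w' q : rem_over w q -> rem_over w' q -> w = w'.
Proof.
move=> [p wp pq] [p' wp' p'q]; apply: val_inj; rewrite -!set_valE wp wp'.
by congr Some; apply: val_inj; rewrite -!set_valE pq p'q.
Qed.

Lemma rem_over_pt q : ~ rem_over rem_pt q.
Proof. by move=> [p]. Qed.

Lemma rem_over_total w : w = rem_pt \/ exists q, rem_over w q.
Proof.
case E : (set_val w : omega_sigma R X) => [p|]; [right|left].
  by exists (set_val p), p.
by apply: val_inj; rewrite -set_valE E.
Qed.

Lemma rem_over_remainder w q : rem_over w q -> (sX `\` range e) q.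
Proof.
move=> [p wp <-]; split; first exact: set_valP.
by move=> pX; have := set_valP w; apply; exists p.
Qed.

Lemma rem_over_surj q : (sX `\` range e) q -> exists w, rem_over w q.
Proof.
move=> [qs qX]; pose p : set_type sX := SigSub (mem_set qs).
have pW : (~` @omega_sigma_image R X) (Some p : omega_sigma R X).
  by move=> [p' /= p'X [p'p]]; apply: qX; move: p'X; rewrite p'p.
by exists (SigSub (mem_set pW)), p.
Qed.

(** Away from Omega, the remainder carries the topology of the Stone-Cech
    compactification. *)
Lemma rem_nbhs w q (A : set W) : rem_over w q ->
  nbhs w A <-> exists2 C, nbhs q C & rem_lift C `<=` A.
Proof.
move=> [p wp <-]; split=> [/set_type_nbhsP[B]|[C pC CA]].
  rewrite wp => /set_type_nbhsP[C pC CB] BA; exists C => // w' [_ [p' wp' <-] Cp'].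
  by apply: BA; rewrite /= wp'; apply: CB.
apply/set_type_nbhsP; rewrite wp.
exists (Some @` (set_val @^-1` C : set (set_type sX))).
  apply: one_point_compactification_some_nbhs.
  by apply/set_type_nbhsP; exists C.
move=> w' [p' Cp' p'w]; apply: CA; exists (set_val p') => //; by exists p'.
Qed.

(** A neighborhood of Omega contains all but a compact part of sigma X. *)
Lemma rem_nbhs_pt (A : set W) : nbhs rem_pt A -> exists C : set bX,
  [/\ compact C, C `<=` sX & forall w q, rem_over w q -> ~ C q -> A w].
Proof.
move=> /set_type_nbhsP[B [D [cD clD] DB] BA].
exists (set_val @` D); split.
- apply: continuous_compact cD; apply: continuous_subspaceT.
  exact: initial_continuous.
- by move=> _ [p _ <-]; exact: set_valP.
- move=> w q [p wp pq] nq; apply: BA; rewrite /= wp; apply: DB; left.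
  by exists p => // Dp; apply: nq; exists p.
Qed.

Lemma rem_lift_open (C : set bX) : open C -> open (rem_lift C).
Proof.
move=> oC; rewrite openE => w [q wq Cq]; apply/(rem_nbhs _ wq).
by exists C => //; exact: open_nbhs_nbhs.
Qed.

(** The intrinsic form, in the remainder with its point Omega, of
    compact_open_remainder: it is visibly preserved by homeomorphisms that
    preserve Omega. *)
Definition compact_open_part (G : set W) := [/\ open G, compact G, G !=set0 & ~ G rem_pt].

Lemma rem_liftK K : compact_open_remainder K -> rem_proj (rem_lift K) = K.
Proof.
move=> [_ _ [O _ KE]]; apply/seteqP; split=> q.
  by move=> [w wq [q' wq' Kq']]; rewrite (rem_over_fun wq wq').
move=> Kq; have [w wq] : exists w, rem_over w q.
  by apply: rem_over_surj; move: Kq; rewrite KE => -[].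
by exists w => //; exists q.
Qed.

Lemma rem_projK G : ~ G rem_pt -> rem_lift (rem_proj G) = G.
Proof.
move=> nG; apply/seteqP; split=> w.
  by move=> [q wq [w' wq' Gw']]; rewrite (rem_over_inj wq wq').
move=> Gw; have [wpt|[q wq]] := rem_over_total w; first by rewrite wpt in Gw.
by exists q => //; exists w.
Qed.

Lemma compact_open_part_lift K :
  compact_open_remainder K -> compact_open_part (rem_lift K).
Proof.
move=> [clK [q0 Kq0] [O oO KE]].
have surj q : K q -> exists w, rem_over w q.
  by rewrite KE => -[] /rem_over_surj.
split.
- rewrite (_ : rem_lift K = rem_lift O); first exact: rem_lift_open.
  apply/seteqP; split=> w [q wq]; rewrite ?KE; first by move=> [_ Oq]; exists q.
  move=> Oq; exists q => //; split=> //; exact: rem_over_remainder wq.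
- move=> F PF FK.
  have cK : compact K by exact: (subclosed_compact clK (@stone_cech_compact R X)).
  pose pr w : bX := xget q0 [set q | rem_over w q].
  have prE w q : rem_over w q -> pr w = q.
    by move=> wq; apply: xget_unique => // q' /= wq'; exact: rem_over_fun wq' wq.
  have [|q [Kq qF]] := cK (pr @ F) _.
    by apply: (@filterS _ F _ _ _ _ FK) => w [q wq Kq]; rewrite /= (prE _ _ wq).
  have [w wq] := surj q Kq; exists w; split; first by exists q.
  move=> A B FA /(rem_nbhs _ wq)[C qC CB].
  have [|_ [[w' [Aw' [q' wq' Kq']] <-] Cw']] := qF (pr @` (A `&` rem_lift K)) C _ qC.
    have FAK : F (A `&` rem_lift K) by exact: filterI.
    by apply: (@filterS _ F _ _ _ _ FAK) => z Az; exists z.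
  exists w'; split=> //; apply: CB; exists q' => //.
  by move: Cw'; rewrite (prE _ _ wq').
- by have [w wq] := surj q0 Kq0; exists w, q0.
- by move=> [q /rem_over_pt].
Qed.

Lemma compact_open_part_proj G :
  compact_open_part G -> compact_open_remainder (rem_proj G).
Proof.
move=> [oG cG [w0 Gw0] nG].
have ov w : G w -> exists q, rem_over w q.
  by move=> Gw; have [wpt|//] := rem_over_total w; rewrite wpt in Gw.
have [q0 wq0] := ov w0 Gw0.
split; last 1 first.
- exists (\bigcup_(C in [set C | open C /\ rem_lift C `<=` G]) C).
    by apply: bigcup_open => C [].
  apply/seteqP; split=> q.
    move=> [w wq Gw]; split; first exact: rem_over_remainder wq.
    have /(rem_nbhs _ wq)[C] : nbhs w G by exact: open_nbhs_nbhs.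
    rewrite nbhsE => -[C' [oC' C'q] C'C] CG; exists C' => //; split=> //.
    by move=> w' [q' wq' Cq']; apply: CG; exists q' => //; exact: C'C.
  move=> [/rem_over_surj[w wq] [C [_ CG] Cq]]; exists w => //.
  by apply: CG; exists q.
- apply: compact_closed; first exact: stone_cech_hausdorff.
  move=> F PF FG.
  pose s q := xget rem_pt [set w | rem_over w q].
  have sE w q : rem_over w q -> s q = w.
    by move=> wq; apply: xget_unique => // w' /= wq'; exact: rem_over_inj wq' wq.
  have [|w [Gw wF]] := cG (s @ F) _.
    by apply: (@filterS _ F _ _ _ _ FG) => q [w wq Gw]; rewrite /= (sE _ _ wq).
  have [q wq] := ov w Gw; exists q; split; first by exists w.
  move=> A C FA qC.
  have [||_ [[a [Aa [w' w'a Gw']] <-] [c sc Cc]]] :=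
      wF (s @` (A `&` rem_proj G)) (rem_lift C).
  - have FAG : F (A `&` rem_proj G) by exact: filterI.
    by apply: (@filterS _ F _ _ _ _ FAG) => z Az; exists z.
  - by apply/(rem_nbhs _ wq); exists C.
  exists a; split=> //; move: sc; rewrite (sE _ _ w'a) => w'c.
  by rewrite (rem_over_fun w'a w'c).
- by exists q0, w0.
Qed.

End remainder.

Lemma compact_open_part_homeo (R : realType) (X Y : topologicalType)
    (f : omega_sigma_remainder R X -> omega_sigma_remainder R Y)
    (k : omega_sigma_remainder R Y -> omega_sigma_remainder R X) G :
  continuous f -> continuous k -> cancel f k -> cancel k f ->
  f (rem_pt R X) = rem_pt R Y -> compact_open_part G -> compact_open_part (f @` G).
Proof.
move=> cf ck fk kf fpt [oG cG [w Gw] nG]; split.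
- rewrite (_ : f @` G = k @^-1` G); first by move/continuousP: ck; apply.
  apply/seteqP; split=> [_ [x Gx <-]|y Gy]; first by rewrite /= fk.
  by exists (k y) => //; rewrite kf.
- by apply: continuous_compact cG; exact: continuous_subspaceT.
- by exists (f w), w.
- by move=> [x Gx]; rewrite -fpt => /(can_inj fk) xpt; apply: nG; rewrite -xpt.
Qed.

(** * The point at infinity of the remainder *)

(** Some neighborhood of x has density at most the continuum; the family h may
    also take values outside of that neighborhood. *)
Definition locally_cantor_dense (T : topologicalType) (x : T) :=
  exists2 U, nbhs x U & exists h : (nat -> bool) -> T,
    forall O, open O -> O `&` U !=set0 -> exists s, O (h s).

Lemma locally_cantor_dense_homeo (S T : topologicalType) (f : S -> T)
    (k : T -> S) x : continuous f -> continuous k -> cancel f k -> cancel k f ->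
  locally_cantor_dense x -> locally_cantor_dense (f x).
Proof.
move=> cf ck fk kf [U xU [h hP]]; exists (k @^-1` U).
  by apply: (ck (f x)); rewrite fk.
exists (f \o h) => O oO [y [Oy Uy]].
apply: (hP (f @^-1` O)); first by move/continuousP: cf; apply.
by exists (k y); split=> //=; rewrite kf.
Qed.

Section point_at_infinity.
Variables (R : realType) (X : topologicalType) (d : X -> X -> R).
Hypothesis dP : compatible_metric d.
Variable rho : X -> R.
Hypothesis rho_gt0 : forall x, 0 < rho x.
Hypothesis rho_lip : forall x y, rho x <= rho y + d x y.
Hypothesis rho_compact : forall x, compact [set y | d x y <= rho x].
Local Notation bX := (stone_cech R X).
Local Notation e := (@stone_cech_in R X).
Local Notation block := (block d rho).

(** A point q of the remainder lies in the closure of a block, which has a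
    dense sequence D; the closures of the subsets of D, of which there are at
    most continuum many, reach into every open set meeting that closure. *)
Lemma rem_over_locally_cantor_dense (w : omega_sigma_remainder R X) (q : bX) :
  rem_over w q -> locally_cantor_dense w.
Proof.
move=> wq; have [/(sigma_set_block dP rho_gt0 rho_lip rho_compact)[B bB qB] _] :=
  rem_over_remainder wq.
have cB := block_clopen dP rho_gt0 rho_lip bB.
have [D BD] := block_dense_seq dP rho_compact bB.
exists (rem_lift (closure (e @` B))).
  apply/(rem_nbhs _ wq); exists (closure (e @` B)) => //.
  by apply: open_nbhs_nbhs; split=> //; exact: clopen_closure_open.
(* nat -> bool indexes the subsets of the dense sequence *)
pose S (s : nat -> bool) := closure (e @` (D @` [set n | is_true (s n)])).
exists (fun s => xget w (rem_lift (S s))) => O oO [w1 [Ow1 [q1 wq1 Bq1]]].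
have /(rem_nbhs _ wq1)[C q1C CO] : nbhs w1 O by exact: open_nbhs_nbhs.
have [V q1V VC] : exists2 V, nbhs q1 V & closure V `<=` C.
  have sc_compact := @stone_cech_compact R X.
  exact: (compact_regular (@stone_cech_hausdorff R X) sc_compact filterT q1C).
move: q1V; rewrite nbhsE => -[V' [oV' V'q1] V'V].
exists (fun n => `[< V' (e (D n)) >]); set s := fun n => _.
have sC q' : S s q' -> C q'.
  move=> h; apply: VC; apply: closureS h => _ [_ [n /asboolP Vn <-] <-].
  exact: V'V.
have q1S : S s q1.
  move=> N q1N.
  have : nbhs q1 (V' `&` N) by apply: filterI => //; exact: open_nbhs_nbhs.
  rewrite nbhsE => -[N' [oN' N'q1] N'VN].
  have [_ [[x Bx <-] Nx]] := Bq1 N' (open_nbhs_nbhs (conj oN' N'q1)).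
  have xN' : nbhs x (e @^-1` N').
    by apply: stone_cech_in_continuous; exact: open_nbhs_nbhs.
  have [_ [[n _ <-] Nn]] := BD x Bx _ xN'.
  have [V'n NDn] := N'VN _ Nn.
  by exists (e (D n)); split=> //; exists (D n) => //; exists n => //; apply/asboolP.
apply: CO; have : rem_lift (S s) (xget w (rem_lift (S s))).
  by apply: xgetPex; exists w1, q1.
by move=> [q' w'q' Sq']; exists q' => //; exact: sC.
Qed.

(** A sequence meeting each class at most once has no cluster point in X, but
    it has one in the compactification. *)
Lemma discrete_seq_limit (x : nat -> X) :
  (forall m n, sat_class d rho (x m) (x n) -> m = n) ->
  exists2 q, ~ range e q & forall A : set X, (forall n, A (x n)) -> closure (e @` A) q.
Proof.
move=> xinj.
have [q [_ qx]] := @stone_cech_compact R X ((e \o x) @ \oo) _ filterT.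
exists q; last first.
  move=> A Ax B qB; have [|p [Ap Bp]] := qx (e @` A) B _ qB.
    by exists 0%N => // n _; exists (x n).
  by exists p.
move=> [y _ yq].
have cS : clopen (sat_class d rho y).
  by apply: (saturated_clopen dP rho_gt0 rho_lip); exact: sat_class_saturated.
have frequent N : exists2 n, (N <= n)%N & sat_class d rho y (x n).
  have [||_ [[n /= Nn <-] xn]] := qx ((e \o x) @` [set n | (N <= n)%N])
      (closure (e @` sat_class d rho y)).
  - by exists N => // n Nn; exists n.
  - apply: open_nbhs_nbhs; split; first exact: clopen_closure_open.
    rewrite -yq; apply: subset_closure; exists y => //; exact: sat_class_refl.
  exists n => //; rewrite ((closure_id _).1 cS.2).
  exact: (stone_cech_in_closure dP xn).
have [m _ ym] := frequent 0%N; have [n mn yn] := frequent m.+1.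
have : sat_class d rho (x m) (x n) by rewrite -(sat_class_eq dP ym).
by move=> /xinj mE; move: mn; rewrite -mE ltnn.
Qed.

(** Given at most continuum many points of the remainder near infinity, the
    blocks carrying them leave out infinitely many classes, whose union
    contributes to the remainder an open set close to infinity that misses all
    these points. *)
Lemma rem_pt_not_locally_cantor_dense (x0 : X) :
  weight_gt X [set: nat -> bool] -> ~ locally_cantor_dense (rem_pt R X).
Proof.
move=> wX [U /rem_nbhs_pt[C [cC CS CU]] [h hP]].
have [B0 bB0 _] := block_ex dP rho_gt0 rho_lip rho_compact x0.
have [B bB CB] : exists2 B, block B & C `<=` closure (e @` B).
  have [C0|/nonemptyPn ->] := pselect (C !=set0); last by exists B0.
  exact: (compact_sigma_set_block dP rho_gt0 rho_lip rho_compact).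
have /choice[F FP] : forall s, exists F, block F /\
    forall q, rem_over (h s) q -> closure (e @` F) q.
  move=> s; have [hpt|[q hq]] := rem_over_total (h s).
    by exists B0; split=> // q; rewrite hpt => /rem_over_pt.
  have [/(sigma_set_block dP rho_gt0 rho_lip rho_compact)[F bF qF] _] :=
    rem_over_remainder hq.
  by exists F; split=> // q' hq'; rewrite (rem_over_fun hq' hq).
have bFB s : block (F s `|` B) by apply: block_setU => //; case: (FP s).
have [x [xF xinj]] := weight_gt_many_classes dP rho_gt0 rho_lip rho_compact wX bFB.
(* V avoids every block met so far, but is not relatively compact *)
pose V := \bigcup_n sat_class d rho (x n).
have satV : saturated d rho V.
  by apply: saturated_bigcup => n _; exact: sat_class_saturated.
have cV := saturated_clopen dP rho_gt0 rho_lip satV.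
have FV s : (F s `|` B) `&` V = set0.
  apply/seteqP; split=> // y [FBy [n _ /= ny]].
  have sC : saturated d rho (~` (F s `|` B)).
    by apply: (saturatedC dP); case: (bFB s).
  exact: (sat_class_sub sC (xF n s) ny).
have [q qX qx] := discrete_seq_limit xinj.
have qV : closure (e @` V) q.
  by apply: qx => n; exists n => //; exact: sat_class_refl.
have /choice[b bP] : forall n, exists b, block b /\ b (x n).
  move=> n; have [b bb xb] := block_ex dP rho_gt0 rho_lip rho_compact (x n).
  by exists b.
have qS : @sigma_set R X q.
  apply: (block_closure_sigma_set rho_compact (B := \bigcup_n b n)).
    by apply: block_bigcup => n; case: (bP n).
  by apply: qx => n; exists n => //; case: (bP n).
have [w wq] := rem_over_surj (conj qS qX).
have qC : ~ C q.
  move=> /CB qB; apply: (clopen_closure_disjoint cV _ qB) qV.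
  by apply/seteqP; split=> // y [By Vy]; rewrite -(FV (fun=> false)); split=> //; right.
have [||s [q' hq' Vq']] := hP (rem_lift (closure (e @` V))).
- by apply: rem_lift_open; exact: clopen_closure_open.
- by exists w; split; [exists q|exact: CU wq qC].
have [bF /(_ _ hq') qF] := FP s.
apply: (clopen_closure_disjoint cV _ qF) Vq'.
by apply/seteqP; split=> // y [Fy Vy]; rewrite -(FV s); split=> //; left.
Qed.

End point_at_infinity.

(** * The order isomorphism *)

Section locally_compact_classes.
Variables (R : realType) (X : topologicalType).
Hypothesis X_metrizable : metrizable R X.
Hypothesis X_lc : locally_compact [set: X].

Definition ext_trace_class (K : set (stone_cech R X)) : set (one_point_ext R X) :=
  [set Z | ext_trace Z = K].

Lemma ext_trace_class_nonempty K : compact_open_remainder K -> ext_trace_class K !=set0.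
Proof.
have [d dP] := metrizable_compatible X_metrizable.
have [rho [rho0 rhol rhoc]] := compact_radius dP X_lc.
by move=> /(trace_realization dP X_lc rho0 rhol rhoc)[Y _ YK]; exists Y.
Qed.

Lemma ext_classes_KP C : ext_classes_K R X C <->
  exists2 K, compact_open_remainder K & C = ext_trace_class K.
Proof.
have ec (Y : one_point_ext R X) :
    [set Z | ext_equiv Y Z] = ext_trace_class (ext_trace Y).
  apply/seteqP; split=> Z; first by move=> /ext_equivP/esym.
  by move=> YZ; apply/ext_equivP/esym.
split=> [[[Y0 _ <-] [Y Y0Y lcY]]|[K KP ->]].
  exists (ext_trace Y); first exact: ext_trace_locally_compact.
  by rewrite ec; congr ext_trace_class; apply/ext_equivP.
have [d dP] := metrizable_compatible X_metrizable.
have [rho [rho0 rhol rhoc]] := compact_radius dP X_lc.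
have [Y lcY YK] := trace_realization dP X_lc rho0 rhol rhoc KP.
split; first by exists Y => //; rewrite ec YK.
by exists Y.
Qed.

Lemma ext_trace_class_le K1 K2 : compact_open_remainder K1 -> compact_open_remainder K2 ->
  ext_class_le R X (ext_trace_class K1) (ext_trace_class K2) <-> K2 `<=` K1.
Proof.
move=> /ext_trace_class_nonempty[Y1 Y1K] /ext_trace_class_nonempty[Y2 Y2K].
split=> [[Z1 [Z2 [<- <- /ext_leP]]]//|K21].
by exists Y1, Y2; split=> //; apply/ext_leP; rewrite Y1K Y2K.
Qed.

End locally_compact_classes.

(** A homeomorphism of the remainders that matches the points at infinity
    carries compact open parts to compact open parts, and the latter are the
    traces of the locally compact extensions. *)
Lemma order_isomorphic_of_remainder_homeo (R : realType) (X Y : topologicalType)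
    (f : omega_sigma_remainder R X -> omega_sigma_remainder R Y)
    (k : omega_sigma_remainder R Y -> omega_sigma_remainder R X) :
  metrizable R X -> metrizable R Y ->
  locally_compact [set: X] -> locally_compact [set: Y] ->
  continuous f -> continuous k -> cancel f k -> cancel k f ->
  f (rem_pt R X) = rem_pt R Y ->
  order_isomorphic (ext_classes_K R X) (ext_classes_K R Y)
    (ext_class_le R X) (ext_class_le R Y).
Proof.
move=> mX mY lX lY cf ck fk kf fpt.
have kpt : k (rem_pt R Y) = rem_pt R X by rewrite -fpt fk.
pose phi K := rem_proj (f @` rem_lift K).
have phiP K : compact_open_remainder K -> compact_open_remainder (phi K).
  move=> /compact_open_part_lift/(compact_open_part_homeo cf ck fk kf fpt).
  exact: compact_open_part_proj.
have phi_lift K : compact_open_remainder K -> rem_lift (phi K) = f @` rem_lift K.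
  move=> /compact_open_part_lift/(compact_open_part_homeo cf ck fk kf fpt)[_ _ _].
  exact: rem_projK.
have phi_sub K L : compact_open_remainder K -> compact_open_remainder L ->
    phi K `<=` phi L <-> K `<=` L.
  move=> KP LP; split=> [KL|KL q [w wq [v [p vp Kp] vw]]]; last first.
    by exists w => //; exists v => //; exists p => //; apply: KL.
  rewrite -(rem_liftK KP) -(rem_liftK LP) => q [w wq wK]; exists w => //.
  have : (f @` rem_lift L) (f w).
    rewrite -phi_lift//; have : rem_lift (phi K) (f w) by rewrite phi_lift//; exists w.
    by move=> [p fp Kp]; exists p => //; apply: KL.
  by move=> [v Lv /(can_inj fk) <-].
have phi_surj L : compact_open_remainder L ->
    exists2 K, compact_open_remainder K & phi K = L.
  move=> LP; have Lpart := compact_open_part_lift LP.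
  have Kpart := compact_open_part_homeo ck cf kf fk kpt Lpart.
  exists (rem_proj (k @` rem_lift L)); first exact: compact_open_part_proj.
  rewrite /phi rem_projK; last by case: Kpart.
  rewrite -[RHS](rem_liftK LP); congr rem_proj; apply/seteqP; split=> w.
    by move=> [_ [v Lv <-] <-]; rewrite kf.
  by move=> Lw; exists (k w); [exists w|rewrite kf].
pose F (C : set (one_point_ext R X)) :=
  [set Z | exists2 Y0, C Y0 & ext_trace Z = phi (ext_trace Y0)].
have FE K : compact_open_remainder K -> F (ext_trace_class K) = ext_trace_class (phi K).
  move=> /(ext_trace_class_nonempty mX lX)[Y0 Y0K]; apply/seteqP; split=> Z.
    by move=> [Z0 Z0K ZZ0]; rewrite /ext_trace_class /= ZZ0 Z0K.
  by move=> ZK; exists Y0 => //; rewrite ZK Y0K.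
exists F; split; last first.
  move=> C1 C2 /(ext_classes_KP mX lX)[K1 K1P ->] /(ext_classes_KP mX lX)[K2 K2P ->].
  rewrite !FE//; split=> [/(ext_trace_class_le mX lX K1P K2P)|].
    by move=> /(phi_sub _ _ K2P K1P)/(ext_trace_class_le mY lY (phiP _ K1P) (phiP _ K2P)).
  move=> /(ext_trace_class_le mY lY (phiP _ K1P) (phiP _ K2P))/(phi_sub _ _ K2P K1P).
  by move=> /(ext_trace_class_le mX lX K1P K2P).
split.
- move=> C /(ext_classes_KP mX lX)[K KP ->]; apply/(ext_classes_KP mY lY).
  by exists (phi K); [exact: phiP|exact: FE].
- move=> C1 C2; rewrite !inE.
  move=> /(ext_classes_KP mX lX)[K1 K1P ->] /(ext_classes_KP mX lX)[K2 K2P ->].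
  rewrite !FE// => E; have [Z ZK] := ext_trace_class_nonempty mY lY (phiP _ K1P).
  have K12 : phi K1 = phi K2 by rewrite -ZK; move: ZK; rewrite E.
  by congr ext_trace_class; apply/seteqP; split; apply/phi_sub => //; rewrite K12.
- move=> C /(ext_classes_KP mY lY)[L LP ->]; have [K KP KL] := phi_surj L LP.
  exists (ext_trace_class K); last by rewrite FE// KL.
  by apply/(ext_classes_KP mX lX); exists K.
Qed.

(** A homeomorphism of the remainders sends infinity to infinity as soon as its
    source has large weight: no other point fails to be locally of density at
    most the continuum. *)
Lemma remainder_homeo_pt (R : realType) (X Y : topologicalType)
    (f : omega_sigma_remainder R X -> omega_sigma_remainder R Y)
    (k : omega_sigma_remainder R Y -> omega_sigma_remainder R X) :
  metrizable R X -> metrizable R Y ->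
  locally_compact [set: X] -> locally_compact [set: Y] ->
  ~ separable X -> weight_gt X [set: nat -> bool] ->
  continuous f -> continuous k -> cancel f k -> cancel k f ->
  f (rem_pt R X) = rem_pt R Y.
Proof.
move=> mX mY lX lY nsX wX cf ck fk kf.
have [//|[q fq]] := rem_over_total (f (rem_pt R X)); exfalso.
have [d dP] := metrizable_compatible mX.
have [rho [rho0 rhol rhoc]] := compact_radius dP lX.
have [x0 _] : [set: X] !=set0.
  apply: contrapT => /nonemptyPn X0; apply: nsX; exists set0; first exact: countable0.
  by move=> O [x _]; have : [set: X] x by []; rewrite X0.
apply: (rem_pt_not_locally_cantor_dense dP rho0 rhol rhoc x0 wX).
rewrite -[rem_pt R X]fk; apply: (locally_cantor_dense_homeo ck cf kf fk).
have [d' dP'] := metrizable_compatible mY.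
have [rho' [rho0' rhol' rhoc']] := compact_radius dP' lY.
exact: (rem_over_locally_cantor_dense dP' rho0' rhol' rhoc' fq).
Qed.

Theorem theorem4p2 (R : realType) (X Y : topologicalType)
    (X_metrizable : metrizable R X) (Y_metrizable : metrizable R Y)
    (X_locally_compact : locally_compact [set: X])
    (Y_locally_compact : locally_compact [set: Y])
    (X_nonseparable : ~ separable X) (Y_nonseparable : ~ separable Y)
    (weight_XY : weight_gt X [set: nat -> bool] \/
                 weight_gt Y [set: nat -> bool])
    (remainders : homeomorphic (omega_sigma_remainder R X)
                               (omega_sigma_remainder R Y)) :
  order_isomorphic (ext_classes_K R X) (ext_classes_K R Y)
    (ext_class_le R X) (ext_class_le R Y).
Proof.
have [f [cf [k [ck fk kf]]]] := remainders.
apply: (order_isomorphic_of_remainder_homeo _ _ _ _ cf ck fk kf) => //.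
have [wX|wY] := weight_XY.
  exact: remainder_homeo_pt wX cf ck fk kf.
by rewrite -[RHS]kf; congr f; apply/esym; exact: remainder_homeo_pt wY ck cf kf fk.
Qed.
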